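(* For any type $\sigma$ and any sequence of blocks $\delta=(d_1^{m_1},\ldots,d_s^{m_s})$, \[ s_{\sigma}^{\otimes}P_{\delta}=\sum_{\tau} \left[\sum_{T\in\mathrm{TRHT}(\tau/\sigma,\delta)} \operatorname{sgn}(T)\operatorname{wt}(T)\right] s_{\tau}^{\otimes}, \] where the outer sum is over types $\tau$ and $\mathrm{TRHT}(\tau/\sigma,\delta)$ is the set of tensor rim hook tableaux of shape $\tau/\sigma$ and content $\delta$.
   Context: An integer partition is a finite (possibly empty) weakly decreasing sequence of positive integers. A block is an ordered pair of positive integers written $d^m$ (degree $d$, multiplicity $m$). Blocks are ordered by $a^b\ge d^e$ iff $a>d$, or $a=d$ and $b\ge e$. A type is a finite (possibly empty) weakly decreasing sequence of blocks $\tau=(d_1^{m_1},\dots,d_s^{m_s})$. For $k\ge1$, $\tau|_k$ denotes the integer partition formed by the multiplicities of the blocks of $\tau$ of degree $k$; the type $\tau$ is determined by $(\tau|_k)_{k\ge1}$. Variables: $x_{k,j}$ for $k,j\ge 1$, with $\deg x_{k,j}=k$; $\mathbf{x}_{k*}=(x_{k,1},x_{k,2},\dots)$. The algebra $\mathsf{P\Lambda}$ of polysymmetric functions consists of the formal series over $\mathbb{Q}$ of bounded degree in all the $x_{k,j}$ that, for each fixed $k$, are unchanged by any permutation of the variables $\mathbf{x}_{k*}$. Define $s^{\otimes}_\tau=\prod_{k\ge1}s_{\tau|_k}(\mathbf{x}_{k*})$, where $s_\lambda$ is the Schur symmetric function. Define $P_d=\sum_{k\mid d}k\sum_{j\ge1}x_{k,j}^{d/k}$,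 let $P_{d^m}$ be obtained from $P_d$ by replacing every variable $x_{k,j}$ by $x_{k,j}^m$, and set $P_\delta=\prod_{i=1}^sP_{d_i^{m_i}}$ for an ordered sequence of blocks $\delta=(d_1^{m_1},\dots,d_s^{m_s})$. The diagram $\mathrm{dg}(\mu)$ is the set of boxes $(i,j)$ with $1\le i\le\ell(\mu)$, $1\le j\le\mu_i$ (row $1$ at the top). For $\mathrm{dg}(\mu)\subseteq\mathrm{dg}(\nu)$, $\nu/\mu=\mathrm{dg}(\nu)\setminus\mathrm{dg}(\mu)$. It is a $k$-ribbon if it consists of $k$ boxes that can be labeled $b_1,\dots,b_k$ so that for $1<i\le k$, $b_i$ is one unit left of or one unit below $b_{i-1}$. If a ribbon $R$ has boxes in exactly $r$ different rows, $\operatorname{sgn}(R)=(-1)^{r-1}$. Adding a ribbon to $\mathrm{dg}(\mu)$ means passing from $\mu$ to a partition $\nu$ with $\nu/\mu$ a ribbon. A tensor rim hook tableau (TRHT) of shape $\tau/\sigma$ and content $\delta=(d_1^{m_1},\dots,d_s^{m_s})$ is a sequence of types $\sigma=\tau^0,\tau^1,\dots,\tau^s=\tau$ such that, for $1\le i\le s$, $\tau^i$ arises from $\tau^{i-1}$ by adding a $(d_im_i/k_i)$-ribbon $R_i$ to $\mathrm{dg}(\tau^{i-1}|_{k_i})$ for some positive integer $k_i$ dividing $d_i$ (other components unchanged). Its sign is $\prod_i\operatorname{sgn}(R_i)$ and its weight is $\prod_i\operatorname{wt}(R_i)$ with $\operatorname{wt}(R_i)=k_i$. *)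

(* Defs.v *)
From HB Require Import structures.
From mathcomp Require Import all_boot all_order all_algebra.
From mathcomp.finmap Require Import finmap multiset.
From mathcomp Require Import mathcomp_extra boolp classical_sets functions.
From mathcomp Require Import cardinality fsbigop.

Set Implicit Arguments.
Unset Strict Implicit.
Unset Printing Implicit Defensive.

Import GRing.Theory.

Local Open Scope classical_set_scope.
Local Open Scope ring_scope.

(** * Formal power series over the rationals in the variables x_{k,j} *)

(* The variable x_{k,j} is the pair (k, j); a monomial is the multiset of its
   variables, so that the product of monomials is the sum [`+`] of multisets. *)
Notation pvar := (nat * nat)%type.
Notation monom := ({mset pvar})%mset.

(* A formal series is its coefficient function. The alias keeps the Cauchy
   product below apart from the pointwise product of functions. Polysymmetric
   functions are the elements of this ring that have bounded degree and are
   symmetric in (x_{k,j})_j for each k, so that an identity between them is an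
   identity in this ring. *)
Definition pseries : Type := monom -> rat.

HB.instance Definition _ := GRing.Zmodule.copy pseries (monom -> rat).

Definition splits (M : monom) : set (monom * monom) :=
  [set p | (p.1 `+` p.2)%mset = M].

Definition smul (f g : pseries) : pseries :=
  fun M => \sum_(p \in splits M) f p.1 * g p.2.

Definition sone : pseries := fun M => (M == mset0)%:R.

Lemma finite_splits (M : monom) : finite_set (splits M).
Proof.
pose h (t : (size M).-tuple bool * (size M).-tuple bool) : monom * monom :=
  (seq_mset (mask t.1 M), seq_mset (mask t.2 M)).
apply: (@sub_finite_set _ _ (h @` setT)); last exact/finite_image/finite_finset.
have sub (A : monom) : (A `<=` M)%mset ->
    exists t : (size M).-tuple bool, seq_mset (mask t M) = A.
  move=> /msubsetP AM.
  have /count_subseqP[s /subseqP[m /eqP sm ->] Am] :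
      forall x, (count_mem x A <= count_mem x M)%N.
    by move=> x; rewrite !count_mem_mset.
  exists (Tuple sm); rewrite -[RHS]seq_mset_id; apply/eq_seq_msetP.
  by rewrite perm_sym.
move=> [A B] /= AB.
have AM : (A `<=` M)%mset by rewrite -AB; apply/msubsetP => x; rewrite msetE2 leq_addr.
have BM : (B `<=` M)%mset by rewrite -AB; apply/msubsetP => x; rewrite msetE2 leq_addl.
have [t tA] := sub _ AM; have [u uB] := sub _ BM.
by exists (t, u) => //; rewrite /h /= tA uB.
Qed.

Definition down (M : monom) : seq monom :=
  undup [seq p.1 | p <- fset_set (splits M)].

Fact mem_down (M A : monom) : (A \in down M) = (A `<=` M)%mset.
Proof.
rewrite mem_undup; apply/mapP/idP => [[[B C]]|AM].
  rewrite in_fset_set ?inE; last exact: finite_splits.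
  by move=> /= <- ->; apply/msubsetP => x; rewrite msetE2 leq_addr.
exists (A, (M `\` A)%mset) => //.
rewrite in_fset_set ?inE; last exact: finite_splits.
by rewrite /splits /=; exact: msetBDKC.
Qed.


Lemma smulE (f g : pseries) (M N : monom) : (N `<=` M)%mset ->
  smul f g N = \sum_(A <- down M) \sum_(B <- down M)
    (A `+` B == N)%mset%:R * (f A * g B).
Proof.
move=> NM; rewrite /smul (fsbig_finite _ _ (finite_splits N)) /=.
under [RHS]eq_bigr do under eq_bigr do rewrite mulr_natl mulrb.
rewrite -(@big_allpairs _ _ _ _ _ (down M) (down M) (fun p =>
  if (p.1 `+` p.2 == N)%mset then f p.1 * g p.2 else 0)) /=.
rewrite -big_mkcond -[RHS]big_filter; apply: perm_big; apply: uniq_perm.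
- exact: fset_uniq.
- by rewrite filter_uniq// allpairs_uniq ?undup_uniq// => -[? ?] [? ?].
move=> [A B]; rewrite in_fset_set; last exact: finite_splits.
rewrite mem_filter; apply/idP/andP => [|[/= /eqP AB _]]; rewrite inE //=.
move=> AB; split; first by rewrite -AB.
apply/allpairsP; exists (A, B); rewrite !mem_down /=; split=> //.
  by apply: msubset_trans NM; rewrite -AB; apply/msubsetP => x; rewrite msetE2 leq_addr.
by apply: msubset_trans NM; rewrite -AB; apply/msubsetP => x; rewrite msetE2 leq_addl.
Qed.

Fact smulC : commutative smul.
Proof.
move=> f g; apply/funext => M; rewrite !(smulE _ _ (msubset_refl M)) exchange_big.
by apply: eq_bigr => A _; apply: eq_bigr => B _; rewrite msetDC (mulrC (f B)).
Qed.

Fact smul1 : left_id sone smul.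
Proof.
move=> f; apply/funext => M; rewrite (smulE _ _ (msubset_refl M)).
rewrite (bigD1_seq mset0) ?undup_uniq ?mem_down ?msub0set//=.
rewrite [X in _ + X]big1 => [|A A0]; last first.
  by rewrite big1 // => B _; rewrite /sone (negPf A0) mul0r mulr0.
rewrite (bigD1_seq M) ?undup_uniq ?mem_down//= ?msubset_refl//.
rewrite [X in _ + X + _]big1 => [|B BM]; last first.
  by rewrite mset0D (negPf BM) mul0r.
by rewrite mset0D /sone !eqxx !mul1r !addr0.
Qed.

Fact smulDl : left_distributive smul +%R.
Proof.
move=> f g h; apply/funext => M; transitivity (smul f h M + smul g h M); last by [].
rewrite /smul !(fsbig_finite _ _ (finite_splits M)) -big_split /=.
by apply: eq_bigr => p _; rewrite -mulrDl.
Qed.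

Fact smulA_aux (f g h : pseries) (M : monom) :
  smul (smul f g) h M =
  \sum_(A <- down M) \sum_(B <- down M) \sum_(C <- down M)
    ((A `+` B) `+` C == M)%mset%:R * (f A * g B * h C).
Proof.
rewrite (smulE _ _ (msubset_refl M)).
under eq_big_seq => N.
  rewrite mem_down => NM; under eq_bigr do rewrite (smulE _ _ NM) mulr_suml.
  under eq_bigr do under eq_bigr do rewrite mulr_suml.
  under eq_bigr do rewrite mulr_sumr.
  over.
rewrite /=.
under eq_bigr do under eq_bigr do under eq_bigr do rewrite mulr_sumr.
under eq_bigr do rewrite exchange_big.
rewrite exchange_big; apply: eq_bigr => A _.
under eq_bigr do rewrite exchange_big.
rewrite exchange_big; apply: eq_bigr => B _.
rewrite exchange_big; apply: eq_bigr => C _ /=.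
have [ABM|ABM] := boolP (A `+` B \in down M)%mset.
  rewrite (bigD1_seq (A `+` B)%mset) ?undup_uniq//= big1 => [|N NAB].
    by rewrite eqxx mul1r addr0.
  by rewrite [_ == N]eq_sym (negPf NAB) !mul0r mulr0.
rewrite big_seq big1 => [|N NM]; last first.
  have [ABN|_] := eqVneq (A `+` B)%mset N; first by rewrite ABN NM in ABM.
  by rewrite !mul0r mulr0.
case: eqP => [ABC|]; last by rewrite mul0r.
move: ABM; rewrite mem_down -ABC => /msubsetP[] x.
by rewrite [X in (_ <= X)%N]msetE2 leq_addr.
Qed.

Fact smulA : associative smul.
Proof.
move=> f g h; rewrite smulC; apply/funext => M; rewrite !smulA_aux.
under eq_bigr do rewrite exchange_big.
rewrite exchange_big; apply: eq_bigr => A _; apply: eq_bigr => B _.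
apply: eq_bigr => C _; rewrite msetDC msetDA; congr (_ * _).
by rewrite mulrC mulrA.
Qed.

Fact sone_neq0 : sone != 0.
Proof.
apply/eqP => /(congr1 (fun f : pseries => f mset0)).
by rewrite /sone eqxx => /eqP; rewrite oner_eq0.
Qed.

HB.instance Definition _ := GRing.Zmodule_isComNzRing.Build pseries
  smulA smulC smul1 smulDl sone_neq0.

HB.instance Definition _ :=
  GRing.Lmodule.copy pseries (monom -> rat^o).

Definition X (v : pvar) : pseries := fun M => (M == [mset v]%mset)%:R.

(* Formal sum of a possibly infinite family of series in which each monomial
   occurs only finitely often: [\sum_(i \in A)] is the sum over the finite
   support of the summand, and a junk 0 if that support is infinite. *)
Definition fsum (I : choiceType) (A : set I) (F : I -> pseries) : pseries :=
  fun M => \sum_(i \in A) F i M.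

(* Replaces every variable x_{k,j} by x_{k,j}^m: the term c x^N becomes
   c (x^N)^m, and [iter m (msetD N) mset0] is the monomial (x^N)^m. *)
Definition subst_pow (m : nat) (f : pseries) : pseries :=
  fun M => \sum_(N \in [set N : monom | iter m (msetD N) mset0 = M]) f N.

(** * Partitions, blocks and types *)

Notation block := (nat * nat)%type.

(* The pair (d, m) is the block d^m. *)
Definition is_block (b : block) : bool := (0 < b.1)%N && (0 < b.2)%N.

Definition block_ge (b c : block) : bool :=
  (c.1 < b.1)%N || (b.1 == c.1) && (c.2 <= b.2)%N.

Definition is_type (tau : seq block) : bool :=
  all is_block tau && sorted block_ge tau.

(* The partition written tau|_k. *)
Definition component (tau : seq block) (k : nat) : seq nat :=
  [seq b.2 | b <- tau & b.1 == k].

(** * Schur functions and power sums *)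

(* Semistandard tableaux of shape mu, as sequences of rows with positive
   entries. *)
Definition is_ssyt (mu : seq nat) (T : seq (seq nat)) : Prop :=
  [/\ shape T = mu,
      all (all (leq 1)) T,
      all (sorted leq) T
    & forall i j : nat, (i.+1 < size T)%N -> (j < size (nth [::] T i.+1))%N ->
        (nth 0 (nth [::] T i) j < nth 0 (nth [::] T i.+1) j)%N].

(* The Schur function s_mu in the variables x_{k,1}, x_{k,2}, ... *)
Definition schur (k : nat) (mu : seq nat) : pseries :=
  fsum [set T | is_ssyt mu T]
    (fun T => \prod_(row <- T) \prod_(j <- row) X (k, j)).

Definition max_deg (tau : seq block) : nat := (\max_(b <- tau) b.1)%N.

(* For k > max_deg tau the component of tau is empty, and its Schur function
   is 1. *)
Definition schur_tensor (tau : seq block) : pseries :=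
  \prod_(1 <= k < (max_deg tau).+1) schur k (component tau k).

Definition power_sum (d : nat) : pseries :=
  \sum_(k <- divisors d)
    (fsum [set j | (0 < j)%N] (fun j => X (k, j) ^+ (d %/ k))) *+ k.

Definition P_block (b : block) : pseries := subst_pow b.2 (power_sum b.1).

Definition P_content (delta : seq block) : pseries :=
  \prod_(b <- delta) P_block b.

(** * Ribbons *)

Notation box := (nat * nat)%type.

Definition dg (mu : seq nat) : {fset box} :=
  [fset c in [seq (i, j) | i <- iota 1 (size mu),
                           j <- iota 1 (nth 0%N mu i.-1)]]%fset.

(* [c'] is one unit left of, or one unit below, [c]; row 1 is at the top. *)
Definition ribbon_next (c c' : box) : bool :=
  (c == (c'.1, c'.2.+1)) || (c' == (c.1.+1, c.2)).

Definition is_ribbon (r : nat) (R : {fset box}) : Prop :=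
  exists b : seq box,
    [/\ uniq b, size b = r, R = [fset c in b]%fset & sorted ribbon_next b].

Definition adds_ribbon (r : nat) (mu nu : seq nat) : Prop :=
  (dg mu `<=` dg nu)%fset /\ is_ribbon r (dg nu `\` dg mu)%fset.

Definition ribbon_sgn (R : {fset box}) : rat :=
  (-1) ^+ (#|` [fset c.1 | c in R]%fset|).-1.

(** * Tensor rim hook tableaux *)

Definition trht_step (b : block) (sigma tau : seq block) : Prop :=
  exists k : nat,
    [/\ (0 < k)%N, (k %| b.1)%N,
        adds_ribbon ((b.1 * b.2) %/ k) (component sigma k) (component tau k)
      & forall l : nat, l <> k -> component tau l = component sigma l].

(* The list [T] is the sequence tau^0, ..., tau^s of types. *)
Definition is_trht (tau sigma delta : seq block) (T : seq (seq block)) : Prop :=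
  [/\ size T = (size delta).+1, all is_type T,
      nth [::] T 0 = sigma, nth [::] T (size delta) = tau
    & forall i : nat, (i < size delta)%N ->
        trht_step (nth (0, 0)%N delta i) (nth [::] T i) (nth [::] T i.+1)].

(* The integer k of a step from sigma to tau: the added ribbon is nonempty, so
   k is the only degree in which the two types differ, and it occurs in tau. *)
Definition step_deg (sigma tau : seq block) : nat :=
  head 0%N [seq k <- map fst tau | component tau k != component sigma k].

Definition step_ribbon (sigma tau : seq block) : {fset box} :=
  let k := step_deg sigma tau in
  (dg (component tau k) `\` dg (component sigma k))%fset.

Definition trht_sgn (T : seq (seq block)) : rat :=
  \prod_(i < (size T).-1)
    ribbon_sgn (step_ribbon (nth [::] T i) (nth [::] T i.+1)).

Definition trht_wt (T : seq (seq block)) : rat :=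
  \prod_(i < (size T).-1) (step_deg (nth [::] T i) (nth [::] T i.+1))%:R.

(* Main.v *)
From HB Require Import structures.
Require Import Defs.
From mathcomp Require Import all_boot all_order all_algebra.
From mathcomp Require Import fingroup perm zify.
From mathcomp.finmap Require Import finmap multiset.
From mathcomp Require Import mathcomp_extra boolp classical_sets functions.
From mathcomp Require Import cardinality fsbigop.
Import GRing.Theory.
Local Open Scope classical_set_scope.
Local Open Scope ring_scope.

Set Implicit Arguments.
Unset Strict Implicit.
Unset Printing Implicit Defensive.

(** The series P of the block d^m is the sum, over the divisors k of d, of k
    times the power sum p_r of degree r = dm/k in the variables x_(k,1),
    x_(k,2), ... ([P_blockE]). Multiplying a product of Schur functions, one
    for each degree, by such a power sum only changes the factor of degree k,
    so the theorem is an iteration of the Murnaghan-Nakayama rule: s_l p_r is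
    the sum of sgn(nu/l) s_nu over the partitions nu such that nu/l is an
    r-ribbon ([murnaghan_nakayama]). Choosing k and then a ribbon is choosing
    a step of a tensor rim hook tableau, and the factor k is the weight of the
    step ([schur_tensor_P_block]).

    The Murnaghan-Nakayama rule is proved from the tableau definition of the
    Schur functions, by induction on the number N of variables. A partition l
    with at most n rows is encoded by n beads at the positions
    a_i = l_i + n - 1 - i. Advancing one bead by r and sorting the beads
    amounts to adding an r-ribbon, and the sign of the sorting permutation is
    the sign of the ribbon ([sum_bump_moves]). It thus suffices to find an
    antisymmetric function A_N of the bead positions, sorted or not, that is
    s_l(x_1, ..., x_N) at the beads of l and satisfies
    sum_i A_N(a + r e_i) = p_r(x_1, ..., x_N) A_N(a).

    Erasing the entries N + 1 of a tableau removes a horizontal strip, which on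
    beads is the interlacing condition a_(i+1) < b_i <= a_i. Since A_N is
    antisymmetric, the sum of x^(|a|-|b|) A_N(b) over the interlacing b is also
    the sum over all b such that b_i <= a_i for every i, because the other
    terms cancel in pairs ([branch_interlacing]). This larger sum defines
    A_(N+1), and it is a sum over a box: the bead relation passes from A_N to
    A_(N+1) by shifting one coordinate of b, up to the terms where the shifted
    coordinate is less than r, which add up to x^r A_(N+1)(a)
    ([branch_bump]). This last point uses that A_N(b) vanishes unless a bead
    of b is at position 0, which is true for n > N: a partition with n nonempty
    rows has no tableau with entries at most N ([needs_low_alt_schur]).

    Finally, an identity of series is checked at each monomial, which involves
    finitely many variables and so allows the use of finite N and n. *)

(** * Antisymmetric functions of bead positions *)

HB.lock Definition below n (a : {ffun 'I_n -> nat}) : seq {ffun 'I_n -> nat} :=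
  filter (fun b : {ffun 'I_n -> nat} => [forall i, b i <= a i]%N)
    [seq ([ffun i => val (f i)] : {ffun 'I_n -> nat})
      | f : {ffun 'I_n -> 'I_(\max_i a i).+1}].

Section BetaNumbers.

Variables (R : comNzRingType) (n : nat).
Hypothesis tf : forall f : R, f *+ 2 = 0 -> f = 0.

Notation vec := {ffun 'I_n -> nat}.
Implicit Types (a b c : vec) (G : vec -> R) (i j : 'I_n).

Lemma eq_oppr_eq0 (f : R) : f = - f -> f = 0.
Proof. by move=> ff; apply: tf; rewrite mulr2n {1}ff addNr. Qed.

(** The form in which terms cancel in pairs below: a fixed point of [phi] is
    allowed, as its term is then its own opposite, hence 0. *)
Lemma sum_involution_eq0 (T : eqType) (s : seq T) (phi : T -> T) (F : T -> R) :
    uniq s -> {in s, forall u, phi u \in s} ->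
    {in s, forall u, phi (phi u) = u} -> {in s, forall u, F (phi u) = - F u} ->
  \sum_(u <- s) F u = 0.
Proof.
move=> us phis phiK Fphi; apply: eq_oppr_eq0.
have inj : {in s &, injective phi}.
  by move=> u v /phiK {2}<- /phiK {2}<- ->.
have perm_phi : perm_eq s (map phi s).
  have us' : uniq (map phi s) by rewrite map_inj_in_uniq.
  apply: uniq_perm => // u; apply/idP/mapP => [us0|[v vs ->]]; last exact: phis.
  by exists (phi u); rewrite ?phis ?phiK.
rewrite {1}(perm_big _ perm_phi) big_map -sumrN !big_seq; apply: eq_bigr => u us0 /=.
by rewrite Fphi.
Qed.

Lemma mem_below a b : (b \in below a) = [forall i, b i <= a i]%N.
Proof.
rewrite below.unlock mem_filter andb_idr// => /forallP ba; apply/mapP.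
exists [ffun i => inord (b i)]; rewrite ?mem_enum//; apply/ffunP => i; rewrite !ffunE /= inordK//.
by rewrite ltnS (leq_trans (ba i))// leq_bigmax.
Qed.

Lemma belowP a b : reflect (forall i : 'I_n, (b i <= a i)%N) (b \in below a).
Proof. by rewrite mem_below; apply: forallP. Qed.

Lemma eq_vec a b : (forall i : 'I_n, a i = b i) -> a = b.
Proof. by move=> ab; apply/ffunP. Qed.

Lemma below_uniq a : uniq (below a).
Proof.
rewrite below.unlock filter_uniq// map_inj_uniq ?enum_uniq// => f g /ffunP fg.
by apply/ffunP => i; apply: val_inj; have := fg i; rewrite !ffunE.
Qed.

Definition sum_vec a : nat := (\sum_i a i)%N.

Definition swap i j a : vec := [ffun k => a (tperm i j k)].

Definition bump_at r i a : vec := [ffun k => (if k == i then a k + r else a k)%N].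

Lemma swapE i j a k : swap i j a k = a (tperm i j k).
Proof. by rewrite ffunE. Qed.

Lemma bump_atE r i a k : bump_at r i a k = (if k == i then a k + r else a k)%N.
Proof. by rewrite ffunE. Qed.

Lemma swapK i j : involutive (swap i j).
Proof. by move=> a; apply: eq_vec => k; rewrite !swapE tpermK. Qed.

Lemma sum_swap i j a : sum_vec (swap i j a) = sum_vec a.
Proof.
rewrite /sum_vec [RHS](reindex_inj (@perm_inj _ (tperm i j))) /=.
by apply: eq_bigr => k _; rewrite swapE.
Qed.

Lemma sum_bump_at r i a : sum_vec (bump_at r i a) = (sum_vec a + r)%N.
Proof.
rewrite /sum_vec; under eq_bigr do rewrite bump_atE.
rewrite (bigD1 i)//= eqxx [in RHS](bigD1 i)//= addnAC; congr (_ + _ + _)%N.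
by apply: eq_bigr => k /negPf ->.
Qed.

Lemma sum_below a b : b \in below a -> (sum_vec b <= sum_vec a)%N.
Proof. by move=> /belowP ba; apply: leq_sum => i _. Qed.

Lemma mem_swap_below i j a b : (swap i j b \in below (swap i j a)) = (b \in below a).
Proof.
apply/belowP/belowP => ba k.
  by have := ba (tperm i j k); rewrite !swapE tpermK.
by rewrite !swapE.
Qed.

Definition alternating G : Prop :=
  forall i j a, i != j -> G (swap i j a) = - G a.

(** The functions that vanish unless each of the positions 0, ..., m - 1 holds a
    bead. At the beads of a partition, the condition is that its last m rows are
    empty. *)
Definition needs_low m G : Prop :=
  forall a v, (v < m)%N -> (forall i, a i != v) -> G a = 0.

Lemma alternating_dup G i j a : alternating G -> i != j -> a i = a j -> G a = 0.
Proof.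
move=> altG ij aij; apply: eq_oppr_eq0; rewrite -(altG i j)//; congr G.
by apply: eq_vec => k; rewrite swapE; case: tpermP => [->|->|].
Qed.

(** The effect of one more variable [x] on an antisymmetric function of the
    beads. All [b] below [a] are summed, and not only those that interlace with
    [a], so that the range is a box. *)
Definition branch x G a : R :=
  \sum_(b <- below a) x ^+ (sum_vec a - sum_vec b) * G b.

Lemma alternating_branch x G : alternating G -> alternating (branch x G).
Proof.
move=> altG i j a ij; rewrite /branch -sumrN.
rewrite (perm_big (map (swap i j) (below a))) ?big_map.
  by apply: eq_bigr => b _; rewrite altG// !sum_swap mulrN.
have swap_inj := can_inj (swapK i j).
apply: uniq_perm; rewrite ?map_inj_uniq ?below_uniq// => b.
by rewrite -[b in LHS](swapK i j) mem_swap_below -{2}[b](swapK i j) mem_map.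
Qed.

(** If no bead of [a] is at [v], then exchanging the values [v] and [v + 1] maps
    the set of all [b] below [a] to itself. It changes the sign of [G b], since
    both values occur in [b] when [G b] is not zero. *)
Lemma needs_low_branch x m G : alternating G -> needs_low m.+1 G ->
  needs_low m (branch x G).
Proof.
move=> altG lowG a v vm va.
pose tau (u : nat) := if u == v then v.+1 else if u == v.+1 then v else u.
have tauK : involutive tau by move=> u; rewrite /tau; repeat case: eqP; lia.
pose phi b : vec := [ffun i => tau (b i)].
have phiE b i : phi b i = tau (b i) by rewrite ffunE.
have phiK : involutive phi by move=> b; apply: eq_vec => i; rewrite !phiE tauK.
apply: (@sum_involution_eq0 _ _ phi); rewrite ?below_uniq// => b.
  move=> /belowP ba; apply/belowP => i; rewrite phiE /tau.
  by have := ba i; have := va i; repeat case: eqP; lia.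
have dup c i j : i != j -> c i = c j -> G c = 0 by exact: alternating_dup.
move=> ba; have [/existsP[i /eqP bi]|] := boolP [exists i, b i == v]; last first.
  rewrite negb_exists => /forallP bv; rewrite (lowG b v) ?mulr0 ?oppr0//; last lia.
  rewrite (lowG _ v.+1) ?mulr0// => i; rewrite phiE /tau.
  by have := bv i; repeat case: eqP; lia.
have [/existsP[j /eqP bj]|] := boolP [exists j, b j == v.+1]; last first.
  rewrite negb_exists => /forallP bv; rewrite (lowG b v.+1) ?mulr0 ?oppr0//.
  rewrite (lowG _ v) ?mulr0//; first lia; move=> j; rewrite phiE /tau.
  by have := bv j; repeat case: eqP; lia.
have ij : i != j by apply/eqP => ij; move: bj; rewrite -ij bi; lia.
have [/injectiveP binj|/injectivePn[k [l kl bkl]]] := boolP (injectiveb b).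
  have -> : phi b = swap i j b.
    apply: eq_vec => k; rewrite phiE swapE /tau; case: tpermP => [->|->|ki kj].
    - by rewrite bi bj eqxx.
    - by rewrite bi bj; case: eqP; rewrite ?eqxx; lia.
    rewrite -bj -bi; case: eqP => [/binj//|_]; case: eqP => [/binj//|//].
  by rewrite sum_swap altG// mulrN.
by rewrite (dup b k l)// (dup (phi b) k l) ?mulr0 ?oppr0// !phiE bkl.
Qed.

(** When [G b] is not zero, exactly one bead of [b] is at position 0. This serves
    to insert or remove a sum over the place of that bead. *)
Lemma sum_zero_position G b : alternating G -> needs_low 1 G ->
  \sum_i (b i == 0)%:R * G b = G b.
Proof.
move=> altG lowG; have [/existsP[i /eqP bi]|] := boolP [exists i, b i == 0]; last first.
  rewrite negb_exists => /forallP b0; rewrite (lowG b 0)//.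
  by rewrite big1// => i _; rewrite mulr0.
rewrite (bigD1 i)//= bi eqxx mul1r big1 ?addr0// => j ji.
case: eqP => [bj|]; last by rewrite mul0r.
by rewrite (alternating_dup altG ji) ?mulr0// bi bj.
Qed.

(** The terms of the left-hand side are indexed by a row [i] and some [b] below
    the bumped [a]. Those with [b i >= r] come from some [c] below [a] by adding
    [r] to [c i], and give the summand [p]. Those with [b i = 0] give the summand
    [x ^+ r]. In the remaining ones [0 < b i < r] while another bead [b j] is at
    0; exchanging these two beads and the roles of [i] and [j] cancels them. *)
Lemma branch_bump x r G a p : (0 < r)%N -> alternating G -> needs_low 1 G ->
    (forall c, \sum_i G (bump_at r i c) = p * G c) ->
  \sum_i branch x G (bump_at r i a) = (p + x ^+ r) * branch x G a.
Proof.
move=> r0 altG lowG pG.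
pose wt b := x ^+ (sum_vec a + r - sum_vec b) * G b.
have -> : \sum_i branch x G (bump_at r i a) =
    \sum_i \sum_(b <- below (bump_at r i a)) wt b.
  by apply: eq_bigr => i _; apply: eq_bigr => b _; rewrite sum_bump_at.
have high i : \sum_(b <- below (bump_at r i a) | (r <= b i)%N) wt b =
    \sum_(c <- below a) x ^+ (sum_vec a - sum_vec c) * G (bump_at r i c).
  rewrite -big_filter (perm_big (map (bump_at r i) (below a))).
    rewrite big_map; apply: eq_bigr => c _.
    by rewrite /wt sum_bump_at subnDr.
  have inj : injective (bump_at r i).
    move=> b c /ffunP bc; apply: eq_vec => k.
    by have := bc k; rewrite !bump_atE; case: eqP => // _ /addIn.
  apply: uniq_perm; rewrite ?filter_uniq ?map_inj_uniq ?below_uniq// => b.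
  rewrite mem_filter; apply/andP/mapP => [[rb /belowP ba]|[c]].
    exists [ffun k => if k == i then b k - r else b k]%N.
      apply/belowP => k; rewrite ffunE; have := ba k; rewrite bump_atE.
      by case: eqP => // _; rewrite leq_subLR addnC.
    by apply: eq_vec => k; rewrite bump_atE ffunE; case: eqP => // ->; rewrite subnK.
  move=> /belowP ca ->; split; first by rewrite bump_atE eqxx leq_addl.
  by apply/belowP => k; rewrite !bump_atE; have := ca k; case: eqP => // _; rewrite leq_add2r.
have low0 i : \sum_(b <- below (bump_at r i a) | (b i < r)%N) (b i == 0)%:R * wt b =
    \sum_(b <- below a) (b i == 0)%:R * wt b.
  rewrite (bigID (fun b : vec => b i == 0)) [RHS](bigID (fun b : vec => b i == 0)) /=.
  rewrite [X in _ + X = _]big1 => [|b /andP[_ /negPf->]]; last by rewrite mul0r.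
  rewrite [X in _ = _ + X]big1 => [|b /negPf->]; last by rewrite mul0r.
  rewrite !addr0 -big_filter -[RHS]big_filter; apply: perm_big.
  apply: uniq_perm; rewrite ?filter_uniq ?below_uniq// => b.
  rewrite !mem_filter.
  have [bi|] := eqVneq (b i) 0; last by rewrite andbF.
  rewrite bi r0 /=; apply/belowP/belowP => ba k; have := ba k; rewrite bump_atE; case: eqP => // ->.
    by rewrite bi.
  by move=> /leq_trans -> //; rewrite leq_addr.
have low_pos : \sum_i \sum_(b <- below (bump_at r i a) | (b i < r)%N)
    (b i != 0)%:R * wt b = 0.
  (* The terms in which moreover bead [j] is the one at position 0. *)
  pose f i j := \sum_(b <- below (bump_at r i a) | [&& b i < r, b i != 0 & b j == 0]%N) wt b.
  have f_anti i j : f j i = - f i j.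
    have [<-|ij] := eqVneq i j.
      by rewrite /f big_pred0 ?oppr0// => b; case: (b i == 0); rewrite ?andbF.
    rewrite /f -sumrN -big_filter -[RHS]big_filter.
    rewrite (perm_big (map (swap i j) (filter (fun b : vec =>
       [&& b i < r, b i != 0 & b j == 0]%N) (below (bump_at r i a))))).
      by rewrite big_map; apply: eq_bigr => b _; rewrite /wt sum_swap altG// mulrN.
    have inj := can_inj (swapK i j).
    apply: uniq_perm; rewrite ?map_inj_uniq ?filter_uniq ?below_uniq// => b.
    rewrite -[b in RHS](swapK i j) mem_map// !mem_filter !swapE tpermL tpermR.
    case: (b j < r)%N / idP => //= bjr.
    case: eqP => //= bj0; case: eqP => //= bi0.
    apply/belowP/belowP => ba k; rewrite ?swapE ?bump_atE.
      case: tpermP => [->|->|]; rewrite ?bi0//.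
        by rewrite eqxx (leq_trans (ltnW bjr))// leq_addl.
      move=> /eqP/negPf -> /eqP kj.
      by have := ba k; rewrite bump_atE (negPf kj).
    have [->|kj] := eqVneq k j; first by rewrite (leq_trans (ltnW bjr))// leq_addl.
    have [->|ki] := eqVneq k i; first by rewrite bi0.
    have := ba k; rewrite swapE bump_atE (negPf ki) tpermD//; first by rewrite eq_sym.
    by rewrite eq_sym.
  have -> : \sum_i \sum_(b <- below (bump_at r i a) | (b i < r)%N)
    (b i != 0)%:R * wt b = \sum_i \sum_j f i j.
    apply: eq_bigr => i _; rewrite /f.
    under [RHS]eq_bigr do rewrite big_mkcond.
    rewrite exchange_big /= big_mkcond; apply: eq_bigr => b _.
    case: ltnP => _ /=; last by rewrite big1.
    case: eqP => _ /=; first by rewrite mul0r big1.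
    rewrite mul1r /wt -{1}(sum_zero_position b altG lowG) mulr_sumr.
    by apply: eq_bigr => j _; case: eqP; rewrite ?mul1r ?mul0r ?mulr0.
  apply: eq_oppr_eq0; rewrite -sumrN exchange_big; apply: eq_bigr => j _.
  by rewrite -sumrN; apply: eq_bigr => i _; rewrite f_anti.
rewrite mulrDl /branch !mulr_sumr.
under eq_bigr => i _ do rewrite (bigID (fun b : vec => (r <= b i)%N)) /= high.
rewrite big_split /= exchange_big /=; congr (_ + _).
  by apply: eq_bigr => c _; rewrite -mulr_sumr pG mulrCA.
transitivity (\sum_i \sum_(b <- below (bump_at r i a) | (b i < r)%N)
    ((b i == 0)%:R * wt b + (b i != 0)%:R * wt b)).
  apply: eq_bigr => i _; apply: eq_big => [b|b _]; first by rewrite -ltnNge.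
  by case: (b i == 0); rewrite !(mul0r, mul1r, add0r, addr0).
under [LHS]eq_bigr do rewrite big_split.
rewrite big_split /= low_pos addr0.
under [LHS]eq_bigr do rewrite low0.
rewrite exchange_big; apply: eq_big_seq => b /sum_below ba.
under eq_bigr do rewrite /wt mulrCA.
by rewrite -mulr_sumr sum_zero_position// addnC -addnBA// exprD mulrA.
Qed.

Definition interlacing a b : bool :=
  [forall i : 'I_n, forall j : 'I_n, (j == i.+1 :> nat) ==> (a j < b i)%N].

(** If [b i <= a (i + 1)], then exchanging [b i] and [b (i + 1)] gives another
    term with this property and the opposite sign. The interlacing conditions
    are imposed one row at a time from the top, so that the exchange does not
    affect those already imposed. *)
Lemma branch_interlacing x G a : alternating G ->
    (forall i j, (i < j)%N -> (a j < a i)%N) ->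
  branch x G a =
  \sum_(b <- below a | interlacing a b) x ^+ (sum_vec a - sum_vec b) * G b.
Proof.
move=> altG a_decr.
pose P k b := [forall i : 'I_n, forall j : 'I_n,
  (i < k)%N && (j == i.+1 :> nat) ==> (a j < b i)%N].
have PP k b : reflect (forall i j, (i < k)%N -> j = i.+1 :> nat -> (a j < b i)%N) (P k b).
  apply: (iffP forallP) => [H i j ik ji|H i].
    by have /forallP/(_ j) := H i; rewrite ik ji eqxx.
  by apply/forallP => j; apply/implyP => /andP[ik /eqP]; exact: H.
suff PE k : branch x G a =
    \sum_(b <- below a | P k b) x ^+ (sum_vec a - sum_vec b) * G b.
  rewrite (PE n); apply: eq_bigl => b; apply: eq_forallb => i.
  by apply: eq_forallb => j; rewrite ltn_ord.
elim: k => [|k ->]; first by apply: eq_bigl => b; apply/esym/PP.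
case: (ltnP k.+1 n) => [kn|nk]; last first.
  apply: eq_bigl => b; apply/PP/PP => H i j ik ji; last by apply: H => //; lia.
  by apply: H => //; have := ltn_ord j; lia.
pose i := Ordinal (ltnW kn); pose j := Ordinal kn.
have ij : i != j by rewrite -val_eqE /=; lia.
have PS b : P k.+1 b = P k b && (a j < b i)%N.
  apply/PP/andP => [H|[/PP H Hij] i' j'].
    by split; [apply/PP => i' j' ik; apply: H; lia|apply: H].
  rewrite ltnS leq_eqVlt => /orP[/eqP i'k j'k|]; last exact: H.
  have -> : i' = i by exact: val_inj.
  by have -> : j' = j by apply: val_inj; rewrite /= j'k i'k.
rewrite (bigID (fun b : vec => (a j < b i)%N)) /= [X in _ + X](_ : _ = 0).
  by rewrite addr0; apply: eq_bigl => b; rewrite PS.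
rewrite -big_filter.
apply: (@sum_involution_eq0 _ _ (swap i j)) => [|b|b _|b _].
- by rewrite filter_uniq// below_uniq.
- rewrite !mem_filter -leqNgt => /andP[/andP[/PP Pb bi] /belowP ba].
  apply/andP; split; first (apply/andP; split).
  + apply/PP => i' j' i'k j'i'; rewrite swapE tpermD; first exact: Pb.
    * by rewrite -val_eqE /=; lia.
    * by rewrite -val_eqE /=; lia.
  + by rewrite -leqNgt swapE tpermL.
  apply/belowP => l; rewrite swapE; case: tpermP => [->|->|//].
    by rewrite (leq_trans (ba j))// ltnW// a_decr/=.
  by [].
- exact: swapK.
by rewrite sum_swap altG// mulrN.
Qed.

(** The case of no variables: the sign of the permutation that sorts the beads
    if they occupy the positions n - 1, ..., 0, which are those of the empty
    partition, and 0 otherwise. *)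
Definition beta_det a : R := \det (\matrix_(i < n, j < n) (a i == n.-1 - j)%N%:R).

Lemma alternating_beta_det : alternating beta_det.
Proof.
move=> i j a ij; rewrite /beta_det.
have -> : \matrix_(k < n, l < n) (swap i j a k == n.-1 - l)%N%:R =
    xrow i j (\matrix_(k < n, l < n) (a k == n.-1 - l)%N%:R) :> 'M[R]_n.
  by apply/matrixP => k l; rewrite !mxE swapE.
by rewrite xrowE det_mulmx det_perm odd_tperm ij expr1 mulN1r.
Qed.

Lemma needs_low_beta_det : needs_low n beta_det.
Proof.
move=> a v vn va; have vn' : (n.-1 - v < n)%N by lia.
rewrite /beta_det (expand_det_col _ (Ordinal vn')) big1// => i _.
by rewrite !mxE /= (_ : _ == _ = false) ?mul0r//; have := va i; lia.
Qed.

Lemma beta_det_large a i : (n <= a i)%N -> beta_det a = 0.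
Proof.
move=> nai; rewrite /beta_det (expand_det_row _ i) big1// => j _.
by rewrite !mxE /= (_ : _ == _ = false) ?mul0r//; have := ltn_ord j; lia.
Qed.

(** After the bump, the beads would have to fill 0, ..., n - 1, and some bead
    other than the advanced one would be at the position that this one left. So
    [a] has two equal entries, and bumping the one or the other gives opposite
    values. *)
Lemma beta_det_bump r a : (0 < r)%N -> \sum_i beta_det (bump_at r i a) = 0.
Proof.
move=> r0; have alt := alternating_beta_det.
have [/injectiveP ainj|/injectivePn[k [l kl akl]]] := boolP (injectiveb a).
  rewrite big1// => i _; have [ni|in_] := leqP n (a i + r).
    by apply: (@beta_det_large _ i); rewrite bump_atE eqxx.
  apply: (@needs_low_beta_det _ (a i)); first lia.
  move=> j; rewrite bump_atE; have [->|ji] := eqVneq j i; first lia.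
  by apply/eqP => /ainj /eqP; rewrite (negPf ji).
rewrite (bigD1 k)//= (bigD1 l) 1?eq_sym//= big1 => [|i /andP[ik il]].
  rewrite addr0 (_ : bump_at r k a = swap k l (bump_at r l a)) ?alt ?addNr//.
  apply: eq_vec => m; rewrite swapE !bump_atE.
  case: tpermP => [->|->|/eqP/negPf -> /eqP/negPf -> //].
    by rewrite !eqxx akl.
  by rewrite [l == k]eq_sym (negPf kl) akl.
apply: (alternating_dup alt kl).
by rewrite !bump_atE ![_ == i]eq_sym (negPf ik) (negPf il) akl.
Qed.

(** The antisymmetric extension of the Schur polynomials in [x 0, ..., x N.-1] to
    arbitrary bead positions. It is the Jacobi-Trudi determinant of the
    h_(a_i - (n - 1 - j)), expanded one variable at a time. *)
Fixpoint alt_schur (x : nat -> R) N a : R :=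
  if N is N'.+1 then branch (x N') (alt_schur x N') a else beta_det a.

Lemma alternating_alt_schur x N : alternating (alt_schur x N).
Proof. by elim: N => [|N IH]; [exact: alternating_beta_det|exact: alternating_branch]. Qed.

Lemma needs_low_alt_schur x N : needs_low (n - N) (alt_schur x N).
Proof.
elim: N => [|N IH]; first by rewrite subn0; exact: needs_low_beta_det.
have [nN|Nn] := leqP n N; first by rewrite (_ : n - N.+1 = 0)%N //; lia.
apply: needs_low_branch; first exact: alternating_alt_schur.
by rewrite -subSn//.
Qed.

(** The Murnaghan-Nakayama rule in [N] variables, before sorting the beads. *)
Lemma alt_schur_bump x N r a : (0 < r)%N -> (N < n)%N ->
  \sum_i alt_schur x N (bump_at r i a) = (\sum_(j < N) x j ^+ r) * alt_schur x N a.
Proof.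
move=> r0; elim: N a => [|N IH] a Nn.
  by rewrite big_ord0 mul0r; exact: beta_det_bump.
rewrite big_ord_recr; apply: branch_bump => //.
- exact: alternating_alt_schur.
- move=> c v v1; apply: (@needs_low_alt_schur x N); lia.
- by move=> c; apply: IH; lia.
Qed.

End BetaNumbers.

(** * Tableaux and horizontal strips *)

Lemma geq_trans : transitive geq.
Proof. by move=> v u w /= uv vw; exact: leq_trans vw uv. Qed.

(** For a partition [l] padded with zeros, the [m] such that [l] is obtained from
    [m] by adding a horizontal strip, padded to the same length. *)
Fixpoint strips (l : seq nat) : seq (seq nat) :=
  if l is u :: l' then
    [seq m :: p | m <- iota (head 0%N l') (u - head 0%N l').+1, p <- strips l']
  else [:: [::]].

Lemma sorted_geq_nth (l : seq nat) i j :
  sorted geq l -> (i <= j)%N -> (nth 0 l j <= nth 0 l i)%N.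
Proof.
move=> sl ij; have [lj|jl] := leqP (size l) j; first by rewrite nth_default.
have := sorted_leq_nth geq_trans leqnn 0%N sl; apply => //=.
exact: leq_ltn_trans jl.
Qed.

Lemma sorted_geqP (l : seq nat) :
  reflect (forall i, (nth 0 l i.+1 <= nth 0 l i)%N) (sorted geq l).
Proof.
apply: (iffP idP) => [sl i|H]; first exact: sorted_geq_nth.
by apply/(sortedP 0%N) => i _; exact: H.
Qed.

Lemma mem_strips (l m : seq nat) : sorted geq l ->
  reflect (size m = size l /\
           forall i, (nth 0 l i.+1 <= nth 0 m i <= nth 0 l i)%N)
          (m \in strips l).
Proof.
elim: l m => [|u l IH] m sl.
  rewrite inE; apply: (iffP eqP) => [->|[/size0nil ->//]].
  by split=> // i; rewrite !nth_nil.
have sl' := path_sorted sl.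
have hu : (head 0 l <= u)%N by case: (l) sl => //= v l0 /andP[].
apply: (iffP allpairsP) => [[[h p] [hI /(IH _ sl')[sp Hp] ->]]|].
  split=> /=; first by rewrite sp.
  case=> [|i] /=; last exact: Hp.
  by move: hI; rewrite mem_iota /= nth0; lia.
case: m => [[]//|h p [[sp] H]]; exists (h, p); split=> //.
  by rewrite mem_iota; have := H 0%N; rewrite /= nth0; lia.
by apply/(IH _ sl'); split=> // i; exact: (H i.+1).
Qed.

Lemma strips_uniq l : uniq (strips l).
Proof.
elim: l => // u l IH; apply: allpairs_uniq => //; first exact: iota_uniq.
by move=> [h p] [h' p'] _ _ /= [-> ->].
Qed.

Lemma strips_sorted (l m : seq nat) : sorted geq l -> m \in strips l -> sorted geq m.
Proof.
move=> sl /(mem_strips _ sl)[_ H]; apply/sorted_geqP => i.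
by have := H i; have := H i.+1; lia.
Qed.

(** The beads of [l], from the top row down, in decreasing order. *)
Definition beta n (l : seq nat) : {ffun 'I_n -> nat} :=
  [ffun i => nth 0 l (i : 'I_n) + (n.-1 - i)]%N.

Lemma betaE n l (i : 'I_n) : beta n l i = (nth 0 l i + (n.-1 - i))%N.
Proof. by rewrite ffunE. Qed.

Lemma beta_decr n l (i j : 'I_n) : sorted geq l -> (i < j)%N ->
  (beta n l j < beta n l i)%N.
Proof.
move=> sl ij; rewrite !betaE; have := sorted_geq_nth sl (ltnW ij).
by have := ltn_ord j; lia.
Qed.

Lemma beta_inj n : {in [pred l | size l == n] &, injective (beta n)}.
Proof.
move=> l m /eqP ln /eqP mn /ffunP lm; apply: (@eq_from_nth _ 0%N).
  by rewrite ln mn.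
move=> i; rewrite ln => iln; have := lm (Ordinal iln); rewrite !betaE /=; lia.
Qed.

Lemma sum_beta n (l : seq nat) : size l = n ->
  sum_vec (beta n l) = (sumn l + \sum_(i < n) (n.-1 - i))%N.
Proof.
move=> ln; rewrite /sum_vec; under eq_bigr do rewrite betaE.
rewrite big_split /=; congr (_ + _)%N.
by rewrite sumnE (big_nth 0%N) ln big_mkord.
Qed.

Lemma interlacing_strips (R : comNzRingType) n (l : seq nat) (F : {ffun 'I_n -> nat} -> R) :
    size l = n -> sorted geq l ->
  \sum_(b <- below (beta n l) | interlacing (beta n l) b) F b =
  \sum_(m <- strips l) F (beta n m).
Proof.
move=> ln sl; rewrite -big_filter -[RHS](big_map (beta n) predT).
apply: perm_big; apply: uniq_perm.
- by rewrite filter_uniq// below_uniq.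
- rewrite map_inj_in_uniq ?strips_uniq// => m m' /(mem_strips _ sl)[mn _].
  by move=> /(mem_strips _ sl)[mn' _]; apply: beta_inj; rewrite inE ?mn ?mn' ln.
move=> b; rewrite mem_filter; apply/andP/mapP => [[/forallP bi /belowP ba]|].
  have bge (i : 'I_n) : (nth 0 l i.+1 + (n.-1 - i) <= b i)%N.
    have [iN|Ni] := ltnP i.+1 n; last first.
      by rewrite nth_default ?ln//; lia.
    have /forallP/(_ (Ordinal iN)) := bi i.
    by rewrite eqxx betaE /=; lia.
  pose m := mkseq (fun k => oapp (fun i => b i - (n.-1 - i))%N 0%N (insub k : option 'I_n)) n.
  have mE (i : 'I_n) : nth 0 m i = (b i - (n.-1 - i))%N.
    rewrite nth_mkseq// insubT//= => i_n; congr (b _ - _)%N.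
    exact: val_inj.
  exists m; last first.
    by apply: eq_vec => i; rewrite betaE mE subnK//; have := bge i; lia.
  apply/(mem_strips _ sl); rewrite size_mkseq; split => // k.
  have [kn|nk] := ltnP k n; last first.
    by rewrite !nth_default ?size_mkseq ?ln// ltnW.
  rewrite (mE (Ordinal kn)); have := bge (Ordinal kn); have := ba (Ordinal kn).
  by rewrite betaE /=; lia.
move=> [m /(mem_strips _ sl)[mn H] ->]; split.
  apply/forallP => i; apply/forallP => j; apply/implyP => /eqP ji.
  rewrite !betaE ji; have := H i; have := ltn_ord j; lia.
by apply/belowP => i; rewrite !betaE leq_add2r; case/andP: (H i).
Qed.

Definition grow v (l : seq nat) (T : seq (seq nat)) : seq (seq nat) :=
  [seq p.2 ++ nseq (p.1 - size p.2) v | p <- zip l T].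

Lemma size_grow v l T : size T = size l -> size (grow v l T) = size l.
Proof. by move=> Tl; rewrite size_map size_zip Tl minnn. Qed.

Lemma nth_grow v l T i : size T = size l ->
  nth [::] (grow v l T) i =
  nth [::] T i ++ nseq (nth 0%N l i - size (nth [::] T i)) v.
Proof.
move=> Tl; have [il|li] := ltnP i (size l); last first.
  by rewrite !nth_default ?size_grow ?Tl.
rewrite (nth_map (0%N, [::])) ?size_zip ?Tl ?minnn//.
by rewrite nth_zip.
Qed.

(** The semistandard tableaux of shape [l] with entries at most [N], obtained by
    adding the horizontal strip of the entries [N] last. The partition [l] may
    end with zeros, so that [l] and its tableaux keep their number of rows when
    the larger entries are erased. *)
Fixpoint tabs N (l : seq nat) : seq (seq (seq nat)) :=
  if N is N'.+1 then [seq grow N l T | m <- strips l, T <- tabs N' m]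
  else if all (pred1 0%N) l then [:: nseq (size l) [::]] else [::].

Definition bounded N (T : seq (seq nat)) : bool := all (all (leq^~ N)) T.

Lemma boundedP N T :
  reflect (forall i j, (j < size (nth [::] T i))%N -> (nth 0 (nth [::] T i) j <= N)%N)
    (bounded N T).
Proof.
apply: (iffP (all_nthP [::])) => H i.
  move=> j jT; have [iT|Ti] := ltnP i (size T).
    by have /(all_nthP 0%N)/(_ _ jT) := H i iT.
  by move: jT; rewrite nth_default.
by move=> iT; apply/(all_nthP 0%N) => j; exact: H.
Qed.

Lemma shape_nth (T : seq (seq nat)) i : nth 0%N (shape T) i = size (nth [::] T i).
Proof.
have [iT|Ti] := ltnP i (size T); first by rewrite (nth_map [::]).
by rewrite !nth_default ?size_map.
Qed.
Arguments shape_nth T i : clear implicits.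

Definition restrict N (T : seq (seq nat)) : seq (seq nat) :=
  [seq filter (leq^~ N) row | row <- T].

Lemma nth_restrict N T i : nth [::] (restrict N T) i = filter (leq^~ N) (nth [::] T i).
Proof.
have [iT|Ti] := ltnP i (size T); first by rewrite (nth_map [::]).
by rewrite !nth_default ?size_map.
Qed.

Lemma sorted_split N (s : seq nat) : sorted leq s -> all (leq^~ N.+1) s ->
  s = filter (leq^~ N) s ++ nseq (size s - size (filter (leq^~ N) s)) N.+1.
Proof.
elim: s => //= u s IH us /andP[uN sN].
have ss := path_sorted us; have [uN'|uN'] := leqP u N.
  by rewrite /= {1}(IH ss sN).
have uE : u = N.+1 by lia.
have sE : all (fun v => v == N.+1) s.
  apply/allP => v vs; have := allP sN v vs; have := order_path_min leq_trans us.
  by move=> /allP/(_ _ vs); lia.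
have -> : filter (leq^~ N) s = [::].
  apply/eqP; rewrite -(negbK (_ == _)) -has_filter; apply/hasPn => v vs.
  by have := allP sE v vs; lia.
by rewrite /= uE; congr (_ :: _); apply/all_pred1P.
Qed.

Lemma grow_restrict N l T : is_ssyt l T -> bounded N.+1 T ->
  grow N.+1 l (restrict N T) = T.
Proof.
move=> [Tl T0 Ts _] TN; apply: (@eq_from_nth _ [::]).
  by rewrite size_grow -Tl !size_map.
move=> i; rewrite size_grow -Tl ?size_map// => iT.
rewrite nth_grow ?size_map// shape_nth nth_restrict -sorted_split//.
  exact: (all_nthP [::] Ts).
exact: (all_nthP [::] TN).
Qed.

Lemma restrict_grow N l T : size T = size l -> bounded N T ->
  restrict N (grow N.+1 l T) = T.
Proof.
move=> Tl TN; apply: (@eq_from_nth _ [::]); first by rewrite size_map size_grow.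
move=> i; rewrite size_map size_grow// => il.
rewrite nth_restrict nth_grow// filter_cat.
have /(all_nthP [::])/(_ i) := TN; rewrite Tl => /(_ il) /all_filterP ->.
rewrite (_ : filter _ (nseq _ _) = [::]) ?cats0//.
by elim: (_ - _)%N => //= k ->; rewrite ltnn.
Qed.

Lemma nth_filter_leq N (s : seq nat) j : sorted leq s -> all (leq^~ N.+1) s ->
  (j < size s)%N ->
  (j < size (filter (leq^~ N) s))%N = (nth 0 s j <= N)%N.
Proof.
move=> ss sN js; rewrite [in RHS](sorted_split ss sN) nth_cat.
case: ltnP => jf; last by rewrite nth_nseq ltn_sub2r ?ltnn//; lia.
by have /(all_nthP 0%N)/(_ _ jf) := filter_all (leq^~ N) s => ->.
Qed.

Lemma nth_filter_prefix N (s : seq nat) j : sorted leq s -> all (leq^~ N.+1) s ->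
  (j < size (filter (leq^~ N) s))%N -> nth 0 (filter (leq^~ N) s) j = nth 0 s j.
Proof. by move=> ss sN jf; rewrite {2}(sorted_split ss sN) nth_cat jf. Qed.

Lemma sorted_cat_nseq v k (s : seq nat) : sorted leq s -> all (leq^~ v) s ->
  sorted leq (s ++ nseq k v).
Proof.
elim: s => [_ _|u s IH us /= /andP[uv sv]].
  by apply/(sortedP 0%N) => i; rewrite size_nseq => ik; rewrite !nth_nseq ik (ltnW ik).
have := IH (path_sorted us) sv; case: s us {IH sv} => [_|w s /= /andP[uw _] ->].
  by case: k => //= k ->; rewrite uv.
by rewrite uw.
Qed.

Lemma ssyt_size l T : is_ssyt l T -> size T = size l.
Proof. by case=> <- _ _ _; rewrite size_map. Qed.

Lemma ssyt_row l T i : is_ssyt l T -> size (nth [::] T i) = nth 0%N l i.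
Proof. by case=> <- _ _ _; rewrite shape_nth. Qed.

Lemma ssyt_sorted l T i : is_ssyt l T -> sorted leq (nth [::] T i).
Proof.
case=> _ _ /(all_nthP [::]) H _; have [/H//|Ti] := ltnP i (size T).
by rewrite nth_default.
Qed.

Lemma bounded_row N T i : bounded N T -> all (leq^~ N) (nth [::] T i).
Proof.
move=> /(all_nthP [::]) H; have [/H//|Ti] := ltnP i (size T).
by rewrite nth_default.
Qed.

(** The entries of row [i] in the columns of row [i + 1] lie above entries that
    are at most [N + 1], so they are at most [N] and survive: the erased part is
    a horizontal strip. *)
Lemma shape_restrict_strips N l T : sorted geq l -> is_ssyt l T -> bounded N.+1 T ->
  shape (restrict N T) \in strips l.
Proof.
move=> sl Tssyt TN; have [_ _ _ Tc] := Tssyt; have Tl := ssyt_size Tssyt.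
apply/(mem_strips _ sl); rewrite !size_map; split=> // i.
rewrite shape_nth nth_restrict -!(ssyt_row _ Tssyt).
apply/andP; split; last by rewrite size_filter count_size.
case E : (size (nth [::] T i.+1)) => [//|j].
have iT : (i.+1 < size T)%N by rewrite ltnNge; apply: contra_eqN E => Ti; rewrite nth_default.
have jl : (j < size (nth [::] T i))%N.
  rewrite (ssyt_row _ Tssyt) (leq_trans _ (sorted_geq_nth sl (leqnSn i)))//.
  by rewrite -(ssyt_row _ Tssyt) E.
rewrite nth_filter_leq ?(ssyt_sorted _ Tssyt) ?(bounded_row _ TN)//.
have := Tc i j iT; rewrite E ltnSn => /(_ isT).
by have /(all_nthP 0%N)/(_ j) := bounded_row i.+1 TN; rewrite E ltnSn => /(_ isT); lia.
Qed.

Lemma ssyt_restrict N l T : sorted geq l -> is_ssyt l T -> bounded N.+1 T ->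
  is_ssyt (shape (restrict N T)) (restrict N T).
Proof.
move=> sl Tssyt TN; have [Tl T0 Ts Tc] := Tssyt; split=> //.
- apply/allP => _ /mapP[row rT ->]; apply/allP => j; rewrite mem_filter => /andP[_ jr].
  exact: (allP (allP T0 _ rT)).
- apply/allP => _ /mapP[row rT ->]; apply: sorted_filter; first exact: leq_trans.
  exact: (allP Ts _ rT).
move=> i j; rewrite size_map => iT; rewrite !nth_restrict => jf.
have jf' : (j < size (filter (leq^~ N) (nth [::] T i)))%N.
  have := shape_restrict_strips sl Tssyt TN => /(mem_strips _ sl)[_ /(_ i)].
  rewrite shape_nth nth_restrict => /andP[li _]; apply: leq_trans li.
  rewrite -(ssyt_row _ Tssyt); apply: leq_trans jf _; by rewrite size_filter count_size.
rewrite !nth_filter_prefix ?(ssyt_sorted _ Tssyt) ?(bounded_row _ TN)//.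
by apply: Tc => //; apply: leq_trans jf _; rewrite size_filter count_size.
Qed.

Lemma bounded_restrict N T : bounded N (restrict N T).
Proof. by apply/allP => _ /mapP[row rT ->]; exact: filter_all. Qed.

Lemma ssyt_grow N l m T : sorted geq l -> m \in strips l -> is_ssyt m T ->
  bounded N T -> is_ssyt l (grow N.+1 l T).
Proof.
move=> sl /(mem_strips _ sl)[ml H] Tssyt TN; have [Tm T0 Ts Tc] := Tssyt.
have Tl : size T = size l by rewrite (ssyt_size Tssyt).
split.
- apply: (@eq_from_nth _ 0%N); first by rewrite size_map size_grow.
  move=> i _; rewrite shape_nth nth_grow// size_cat size_nseq (ssyt_row _ Tssyt).
  by have := H i; lia.
- apply/(all_nthP [::]) => i; rewrite size_grow// => il; rewrite nth_grow// all_cat.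
  by rewrite (all_nthP [::] T0) ?Tl//= all_nseq orbT.
- apply/(all_nthP [::]) => i; rewrite size_grow// => il; rewrite nth_grow//.
  apply: sorted_cat_nseq; first exact: ssyt_sorted Tssyt.
  by apply: sub_all (bounded_row i TN) => j /= jN; rewrite ltnW.
move=> i j; rewrite size_grow// => il; rewrite !nth_grow// !nth_cat size_cat size_nseq.
rewrite !(ssyt_row _ Tssyt) => jl; have := H i; have := H i.+1 => Hi1 Hi.
have -> : (j < nth 0 m i)%N by lia.
have jT : (j < size (nth [::] T i))%N by rewrite (ssyt_row _ Tssyt); lia.
have /(all_nthP 0%N)/(_ j jT) TjN := bounded_row i TN.
case: (ltnP j) => jm; first by apply: Tc; rewrite ?Tl// (ssyt_row _ Tssyt).
by rewrite nth_nseq ifT//; lia.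
Qed.

Lemma bounded_grow N l T : size T = size l -> bounded N T -> bounded N.+1 (grow N.+1 l T).
Proof.
move=> Tl TN; apply/(all_nthP [::]) => i _; rewrite nth_grow// all_cat.
rewrite all_nseq /= leqnn orbT andbT.
by apply: sub_all (bounded_row i TN) => j /= jN; rewrite leqW.
Qed.

Lemma mem_tabs N l T : sorted geq l ->
  reflect (is_ssyt l T /\ bounded N T) (T \in tabs N l).
Proof.
elim: N l T => [|N IH] l T sl /=.
  apply: (iffP idP) => [|[[Tl T0 Ts Tc] TN]].
    case: ifP => // l0; rewrite inE => /eqP ->.
    have nth0 i : nth [::] (nseq (size l) ([::] : seq nat)) i = [::].
      by rewrite nth_nseq if_same.
    split; last by apply/boundedP => i j; rewrite nth0.
    split.
    - by rewrite /shape map_nseq; apply/esym/all_pred1P.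
    - by rewrite all_nseq orbT.
    - by rewrite all_nseq orbT.
    - by move=> i j _; rewrite nth0.
  have Tnil : all (pred1 [::]) T.
    apply/allP => row rT; have := allP T0 _ rT; have := allP TN _ rT.
    by case: row {rT} => //= u row /andP[u0 _] /andP[]; lia.
  have TE := all_pred1P _ _ Tnil; rewrite -Tl TE /shape map_nseq.
  by rewrite all_nseq orbT size_nseq inE.
apply: (iffP allpairsPdep) => [[m [T' [ml]]]|[Tssyt TN]].
  move=> /(IH _ _ (strips_sorted sl ml))[Tssyt TN] ->.
  have Tl : size T' = size l by rewrite (ssyt_size Tssyt); case/(mem_strips _ sl): ml.
  by split; [exact: ssyt_grow Tssyt TN|exact: bounded_grow].
have ml := shape_restrict_strips sl Tssyt TN.
exists (shape (restrict N T)), (restrict N T); split=> //; last by rewrite grow_restrict.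
apply/(IH _ _ (strips_sorted sl ml)); split; last exact: bounded_restrict.
exact: ssyt_restrict Tssyt TN.
Qed.

Lemma tabs_uniq N l : sorted geq l -> uniq (tabs N l).
Proof.
elim: N l => [|N IH] l sl /=; first by case: ifP.
apply: allpairs_uniq_dep => [|m ml|].
- exact: strips_uniq.
- exact: IH (strips_sorted sl ml).
move=> _ _ /allpairsPdep[m [T [ml Tm ->]]] /allpairsPdep[m' [T' [ml' Tm' ->]]] /= TT'.
have [Tssyt TN] := mem_tabs _ _ (strips_sorted sl ml) Tm.
have [Tssyt' TN'] := mem_tabs _ _ (strips_sorted sl ml') Tm'.
have Tl : size T = size l by rewrite (ssyt_size Tssyt); case/(mem_strips _ sl): ml.
have Tl' : size T' = size l by rewrite (ssyt_size Tssyt'); case/(mem_strips _ sl): ml'.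
have TE : T = T' by rewrite -(restrict_grow Tl TN) TT' restrict_grow.
have mE : m = m' by case: Tssyt Tssyt' => <- _ _ _ [<- _ _ _]; rewrite TE.
by rewrite TE mE.
Qed.

Section TableauSum.

Variables (R : comNzRingType) (x : nat -> R).
Hypothesis tf : forall f : R, f *+ 2 = 0 -> f = 0.

(** The variables are numbered from 0 and the entries of a tableau from 1. *)
Definition tab_weight (T : seq (seq nat)) : R := \prod_(row <- T) \prod_(j <- row) x j.-1.

Lemma tab_weight_grow N l T : size T = size l ->
    (forall i, (size (nth [::] T i) <= nth 0 l i)%N) ->
  tab_weight (grow N.+1 l T) = x N ^+ (sumn l - sumn (shape T)) * tab_weight T.
Proof.
rewrite /tab_weight => Tl H.
have -> : (sumn l - sumn (shape T) = \sum_(p <- zip l T) (p.1 - size p.2))%N.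
  elim: l T Tl H => [|u l IH] [|row T]// => [_ _|[Tl] H]; first by rewrite big_nil.
  rewrite /= big_cons /=.
  rewrite -IH//; last by move=> i; exact: (H i.+1).
  have := H 0%N => /=.
  have : (sumn (shape T) <= sumn l)%N.
    elim: l T Tl {H IH} (fun i => H i.+1) => [|v l IH] [|row' T]// [Tl] H'.
    by rewrite leq_add ?(H' 0%N) ?IH// => i; exact: (H' i.+1).
  lia.
have -> : \prod_(row <- T) \prod_(j <- row) x j.-1 =
    \prod_(p <- zip l T) \prod_(j <- p.2) x j.-1.
  by rewrite -[in LHS](@unzip2_zip _ _ l T) ?Tl// big_map.
rewrite expr_sum /grow big_map -big_split /=; apply: eq_bigr => p _.
rewrite big_cat /= mulrC; congr (_ * _).
by rewrite big_nseq iter_mulr_1.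
Qed.

(** Both sides obey the same recursion on the number of variables: removing the
    entries [N + 1] on the left, and [branch_interlacing] on the right. *)
Lemma sum_tabs_rows n N l : size l = n -> sorted geq l ->
  \sum_(T <- tabs N l) tab_weight T = alt_schur x N (beta n l).
Proof.
move=> ln; elim: N l ln => [|N IH] l ln sl /=.
  case: ifP => [l0|/allPn[u ul u0]].
    rewrite big_seq1 /tab_weight big_nseq big_nil iter_mulr_1 expr1n.
    rewrite /beta_det (_ : \matrix_(_, _) _ = 1%:M) ?det1//.
    apply/matrixP => i j; rewrite !mxE betaE (_ : nth 0%N l i = 0%N).
      congr (_%:R); rewrite add0n -val_eqE /=; have := ltn_ord i; have := ltn_ord j; lia.
    have [il|li] := ltnP i (size l); last by rewrite nth_default.
    exact/eqP/(all_nthP _ l0).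
  have n0 : (0 < n)%N by rewrite -ln; case: (l) ul.
  rewrite big_nil (@beta_det_large _ _ _ (Ordinal n0))// betaE /=.
  have := nth_index 0%N ul; have := sorted_geq_nth sl (leq0n (index u l)).
  by move=> + uE; rewrite uE => ?; move: u0 => /=; lia.
rewrite (branch_interlacing tf _ (alternating_alt_schur x N)); last first.
  by move=> i j; exact: beta_decr.
rewrite interlacing_strips// big_allpairs_dep /=.
apply: eq_big_seq => m ml; have [mn H] := mem_strips _ sl ml.
rewrite -IH ?mn ?(strips_sorted sl ml)// mulr_sumr.
apply: eq_big_seq => T /(mem_tabs _ _ (strips_sorted sl ml))[Tssyt _].
rewrite tab_weight_grow; last first.
- by move=> i; rewrite (ssyt_row _ Tssyt); case/andP: (H i).
- by rewrite (ssyt_size Tssyt).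
rewrite !sum_beta// ?mn// subnDr.
by case: Tssyt => ->.
Qed.

End TableauSum.

(** * Ribbons as bead moves *)

Definition is_part (l : seq nat) : bool := sorted geq l && all (leq 1) l.

Lemma part_sorted l : is_part l -> sorted geq l.
Proof. by case/andP. Qed.

Lemma part_ext l m : is_part l -> is_part m -> nth 0%N l =1 nth 0%N m -> l = m.
Proof.
move=> /andP[_ l0] /andP[_ m0] lm.
have le_size s t : all (leq 1) s -> nth 0%N s =1 nth 0%N t -> (size s <= size t)%N.
  move=> s0 st; rewrite leqNgt; apply/negP => ts.
  have := all_nthP 0%N s0 (size t) ts.
  by rewrite st nth_default.
apply: (@eq_from_nth _ 0%N) => [|i _]; last exact: lm.
by apply/eqP; rewrite eqn_leq !le_size// => i; rewrite lm.
Qed.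

Definition trim (s : seq nat) := filter (leq 1) s.

Lemma trimE s : sorted geq s -> s = trim s ++ nseq (size s - size (trim s)) 0%N.
Proof.
elim: s => //= u s IH us; have ss := path_sorted us.
case: ltnP => u0 /=; first by rewrite {1}(IH ss).
have u00 : u = 0%N by lia.
have s0 : all (pred1 0%N) s.
  apply/allP => v vs.
  by have /allP/(_ _ vs) := order_path_min geq_trans us; rewrite u00 /=; lia.
have -> : trim s = [::].
  by apply/eqP; rewrite -(negbK (_ == _)) -has_filter; apply/hasPn => v /(allP s0)/eqP ->.
by rewrite u00 /=; congr (_ :: _); apply/all_pred1P.
Qed.

Lemma nth_trim s k : sorted geq s -> nth 0%N (trim s) k = nth 0%N s k.
Proof.
move=> /trimE {2}->; rewrite nth_cat; case: ltnP => // ks.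
by rewrite nth_nseq if_same nth_default.
Qed.

Lemma trim_part s : sorted geq s -> is_part (trim s).
Proof.
move=> ss; rewrite /is_part filter_all andbT; apply/sorted_geqP => i.
by rewrite !nth_trim// sorted_geq_nth.
Qed.

Lemma mem_dg mu (c : nat * nat) :
  (c \in dg mu) = (0 < c.1)%N && (0 < c.2 <= nth 0%N mu c.1.-1)%N.
Proof.
case: c => p q; rewrite /dg in_fset /=.
apply/allpairsPdep/idP => [[i [j [iI jI [-> ->]]]]|].
  by move: iI jI; rewrite !mem_iota; lia.
move=> /andP[p0 /andP[q0 qmu]]; exists p, q; rewrite !mem_iota; split=> //; last lia.
rewrite p0 add1n ltnS -[p]prednK// ltnNge.
by apply/negP => mup; move: qmu; rewrite nth_default//; lia.
Qed.

Section Border.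

Variables (f g : nat -> nat).
Hypothesis f_decr : forall k, (f k.+1 <= f k)%N.

(** With [f] and [g] the row lengths of two partitions, this says that the skew
    shape g/f is a ribbon that meets exactly the rows [i0, ..., i0 + m], rows
    being numbered from 0: the last box of each row is right below the first
    box of the previous one. *)
Definition border_strip i0 m : Prop :=
  [/\ (f i0 < g i0)%N,
      forall k, (i0 <= k < i0 + m)%N -> g k.+1 = (f k).+1
    & forall k, ~~ (i0 <= k <= i0 + m)%N -> g k = f k].

Lemma border_strip_lt i0 m k : border_strip i0 m -> (i0 <= k <= i0 + m)%N ->
  (f k < g k)%N.
Proof.
case=> fg0 fgS _ /andP[i0k km]; have [->//|ki0] := eqVneq k i0.
have -> : k = k.-1.+1 by lia.
by rewrite fgS ?ltnS ?f_decr//; lia.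
Qed.

Lemma border_strip_ltE i0 m k : border_strip i0 m ->
  (f k < g k)%N = (i0 <= k <= i0 + m)%N.
Proof.
move=> H; apply/idP/idP => [|/border_strip_lt]; last exact.
by case: H => _ _ H; apply: contraTT => /H ->; rewrite ltnn.
Qed.

(** The boxes are listed from right to left and, in [border], from top to bottom;
    as in [dg], the rows of boxes are numbered from 1. *)
Definition border_row k : seq (nat * nat) := mkseq (fun t => (k.+1, g k - t)%N) (g k - f k).

Definition border i0 m := flatten [seq border_row k | k <- iota i0 m.+1].

Lemma mem_border i0 m (c : nat * nat) :
  (c \in border i0 m) = (i0 < c.1 <= (i0 + m).+1)%N && (f c.1.-1 < c.2 <= g c.1.-1)%N.
Proof.
apply/flatten_mapP/idP => [[k]|].
  rewrite mem_iota => ki /mapP[t]; rewrite mem_iota => ti -> /=; lia.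
case: c => p q /andP[]; rewrite [(p, q).1]/= [(p, q).2]/= => pI qI.
exists p.-1; first by rewrite mem_iota; lia.
apply/mapP; exists (g p.-1 - q)%N; first by rewrite mem_iota; lia.
by congr (_, _); lia.
Qed.

Lemma border_uniq i0 m : uniq (border i0 m).
Proof.
rewrite /border; elim: m.+1 i0 => //= n IH i0.
rewrite cat_uniq IH andbT; apply/andP; split.
  rewrite map_inj_in_uniq ?iota_uniq// => t t'; rewrite !mem_iota => tI t'I [].
  by lia.
apply/hasPn => c /flatten_mapP[k]; rewrite mem_iota => kI /mapP[t _ ->].
by apply/mapP => -[t' _ []]; lia.
Qed.

Lemma border_row_sorted k : sorted ribbon_next (border_row k).
Proof.
apply/(sortedP (0%N, 0%N)) => t; rewrite size_mkseq => tI.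
rewrite !nth_mkseq; try lia.
by rewrite /ribbon_next /= -subnSK ?eqxx//; lia.
Qed.

Lemma head_border_row k : (f k < g k)%N -> head (0%N, 0%N) (border_row k) = (k.+1, g k).
Proof. by rewrite /border_row; case E : (g k - f k)%N => /=; [lia|rewrite subn0]. Qed.

Lemma last_border_row k : (f k < g k)%N ->
  last (0%N, 0%N) (border_row k) = (k.+1, (f k).+1).
Proof.
move=> fg; rewrite -nth_last size_mkseq nth_mkseq; last lia.
by congr (_, _); lia.
Qed.

Lemma sorted_cat (T : Type) (r : rel T) (x0 : T) s1 s2 :
    (0 < size s1)%N -> (0 < size s2)%N ->
    sorted r s1 -> sorted r s2 -> r (last x0 s1) (head x0 s2) ->
  sorted r (s1 ++ s2).
Proof. by case: s1 s2 => [|x s1] [|y s2]//= _ _ p1 p2 r12; rewrite cat_path p1 /= r12. Qed.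

(** The number of boxes follows by telescoping along the rows. *)
Lemma border_sorted i0 m : (f i0 < g i0)%N ->
    (forall k, (i0 <= k < i0 + m)%N -> g k.+1 = (f k).+1) ->
  [/\ head (0%N, 0%N) (border i0 m) = (i0.+1, g i0), sorted ribbon_next (border i0 m)
    & (size (border i0 m) + f (i0 + m) = g i0 + m)%N].
Proof.
elim: m i0 => [|m IH] i0 fg0 fgS.
  have -> : border i0 0 = border_row i0 by rewrite /border /= cats0.
  rewrite size_mkseq addn0 border_row_sorted head_border_row//; split=> //; lia.
have gS := fgS i0; rewrite leqnn -addSnnS leq_addr in gS; have {}gS := gS isT.
have fgS0 : (f i0.+1 < g i0.+1)%N by rewrite gS ltnS f_decr.
have [|k kI|hd srt sz] := IH i0.+1; first by [].
  by apply: fgS; lia.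
have -> : border i0 m.+1 = border_row i0 ++ border i0.+1 m by [].
have row0 : (0 < size (border_row i0))%N by rewrite size_mkseq subn_gt0.
have bd0 : (0 < size (border i0.+1 m))%N by case: (border _ _) hd.
split.
- by rewrite -head_border_row//; case: (border_row i0) row0.
- apply: (@sorted_cat _ _ (0%N, 0%N)) => //; first exact: border_row_sorted.
  by rewrite last_border_row// hd /ribbon_next gS eqxx orbT.
- by rewrite size_cat size_mkseq -addnA addnS -addSn sz gS; lia.
Qed.

End Border.

Lemma ribbon_path_rows (x : nat * nat) s (c : nat * nat) : path ribbon_next x s -> c \in x :: s ->
  (x.1 <= c.1 <= (last x s).1)%N.
Proof.
elim: s x c => [|y s IH] x c /=; first by rewrite inE => _ /eqP ->; rewrite leqnn.
move=> /andP[xy ys]; have xy1 : (x.1 <= y.1)%N.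
  by case/orP: xy => /eqP ->.
rewrite inE => /predU1P[->|cs].
  by rewrite leqnn (leq_trans xy1)//; have /andP[] := IH y y ys (mem_head _ _).
by have /andP[yc ->] := IH y c ys cs; rewrite (leq_trans xy1).
Qed.

(** A ribbon goes from one row to the next only by a step down, so it contains two
    vertically adjacent boxes there. *)
Lemma ribbon_path_cross (x : nat * nat) s k : path ribbon_next x s ->
    (x.1 <= k < (last x s).1)%N ->
  exists2 q, (k, q) \in x :: s & (k.+1, q) \in x :: s.
Proof.
elim: s x => [|y s IH] x /=; first by lia.
move=> /andP[xy ys] kI; have [yk|ky] := leqP y.1 k.
  have [|q kq kq'] := IH y ys; first by lia.
  by exists q; rewrite inE ?kq ?kq' orbT.
have [xk yE] : x.1 = k /\ y = (k.+1, x.2).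
  case/orP: xy => /eqP E; first by move: ky kI; rewrite E /=; lia.
  have xk : x.1 = k by move: ky kI; rewrite E /=; lia.
  by rewrite E xk.
exists x.2; last by rewrite -yE !inE eqxx orbT.
by rewrite -xk -surjective_pairing mem_head.
Qed.

(** Each step of a ribbon decreases the content (column minus row) by 1. Hence a
    ribbon has at most one box on each diagonal. *)
Lemma ribbon_path_content (x : nat * nat) s (c : nat * nat) : path ribbon_next x s -> c \in s ->
  (c.2 + x.1 < x.2 + c.1)%N.
Proof.
elim: s x => [//|y s IH] x /= /andP[xy ys].
have xy' : (y.2 + x.1 < x.2 + y.1)%N by case/orP: xy => /eqP -> /=; lia.
by rewrite inE => /predU1P[->//|cs]; have := IH y ys cs; lia.
Qed.

Lemma ribbon_path_content_inj (x : nat * nat) s (c c' : nat * nat) : path ribbon_next x s ->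
    c \in x :: s -> c' \in x :: s -> (c.2 + c'.1 = c'.2 + c.1)%N -> c = c'.
Proof.
elim: s x => [|y s IH] x; first by rewrite !inE => _ /eqP -> /eqP ->.
move=> xs; have := xs => /= /andP[_ ys]; rewrite inE => /predU1P[->|cs].
  rewrite inE => /predU1P[//|c's].
  by have := ribbon_path_content xs c's; lia.
rewrite inE => /predU1P[->|c's]; last exact: (IH y).
by have := ribbon_path_content xs cs; lia.
Qed.

Section Ribbons.

Variables (l nu : seq nat).
Hypotheses (sl : sorted geq l) (snu : sorted geq nu).
Let f := nth 0%N l.
Let g := nth 0%N nu.

Let f_decr k : (f k.+1 <= f k)%N. Proof. exact: sorted_geqP. Qed.
Let g_decr k : (g k.+1 <= g k)%N. Proof. exact: sorted_geqP. Qed.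

Lemma mem_skew (c : nat * nat) :
  (c \in dg nu `\` dg l)%fset = (0 < c.1)%N && (f c.1.-1 < c.2 <= g c.1.-1)%N.
Proof. by rewrite in_fsetD !mem_dg -/f -/g; lia. Qed.

Lemma border_strip_skew i0 m : border_strip f g i0 m ->
  (dg nu `\` dg l)%fset = [fset c in border f g i0 m]%fset.
Proof.
move=> bs; apply/fsetP => -[p q]; rewrite mem_skew in_fset /= mem_border /=.
apply/idP/idP; last by move=> /andP[pI ->]; rewrite andbT; lia.
move=> /andP[p0 qI]; rewrite qI andbT.
by have := border_strip_ltE f_decr p.-1 bs; lia.
Qed.

Lemma border_strip_adds r i0 m : border_strip f g i0 m ->
  (r + f (i0 + m) = g i0 + m)%N -> adds_ribbon r l nu.
Proof.
move=> bs rE; have [fg0 fgS fgE] := bs; split.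
  apply/fsubsetP => c; rewrite !mem_dg -/f -/g => /andP[-> /andP[-> cf]] /=.
  have [cI|cI] := boolP (i0 <= c.1.-1 <= i0 + m)%N; last by rewrite fgE.
  by apply: (leq_trans cf); apply/ltnW/(border_strip_lt f_decr bs).
exists (border f g i0 m); have [_ srt sz] := border_sorted f_decr fg0 fgS.
split=> //; first exact: border_uniq.
  by lia.
exact: border_strip_skew.
Qed.

Lemma border_strip_sgn i0 m : border_strip f g i0 m ->
  ribbon_sgn (dg nu `\` dg l)%fset = (-1) ^+ m.
Proof.
move=> bs; rewrite /ribbon_sgn.
have -> : [fset c.1 | c in (dg nu `\` dg l)]%fset = [fset k in iota i0.+1 m.+1]%fset.
  apply/fsetP => k; rewrite in_fset; apply/imfsetP/idP => [[[p q]]|].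
    rewrite [_ \in mem _]/= mem_skew [(p, q).1]/= [(p, q).2]/= => /andP[p0 qI] ->; rewrite mem_iota.
    by have := border_strip_ltE f_decr p.-1 bs; lia.
  rewrite mem_iota => kI; have kI' : (i0 <= k.-1 <= i0 + m)%N by lia.
  exists (k, g k.-1) => //=; rewrite mem_skew /= leqnn andbT.
  by rewrite (border_strip_lt f_decr bs kI') andbT; lia.
by rewrite card_fseq undup_id ?iota_uniq// size_iota.
Qed.

(** Two consecutive rows of a ribbon overlap in at least one column by
    [ribbon_path_cross], and in at most one, since otherwise two boxes would lie
    on the same diagonal. *)
Lemma adds_ribbon_border r : (0 < r)%N -> adds_ribbon r l nu ->
  exists i0 m, border_strip f g i0 m /\ (r + f (i0 + m) = g i0 + m)%N.
Proof.
move=> r0 [sub [b [ub sb bE srt]]].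
have fg k : (f k <= g k)%N.
  case: (posnP (f k)) => [->//|fk0].
  have : (k.+1, f k) \in dg l by rewrite mem_dg /= -/f leqnn fk0.
  by move=> /(fsubsetP sub); rewrite mem_dg /= -/g => /andP[].
case: b => [|x s] in ub sb bE srt; first by rewrite -sb in r0.
have memb (c : nat * nat) : (c \in x :: s) = (0 < c.1)%N && (f c.1.-1 < c.2 <= g c.1.-1)%N.
  by rewrite -mem_skew bE in_fset.
have rows c := @ribbon_path_rows x s c srt.
have xI : (0 < x.1)%N && (f x.1.-1 < x.2 <= g x.1.-1)%N by rewrite -memb mem_head.
have lI : (0 < (last x s).1)%N && (f (last x s).1.-1 < (last x s).2 <= g (last x s).1.-1)%N.
  by rewrite -memb mem_last.
have xl := rows x (mem_head _ _).
exists x.1.-1, ((last x s).1 - x.1)%N.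
have bs : border_strip f g x.1.-1 ((last x s).1 - x.1).
  split=> [|k kI|k kI]; first by lia.
    apply/eqP; rewrite eqn_leq; apply/andP; split; last first.
      have [|q] := @ribbon_path_cross x s k.+1 srt; first by lia.
      by rewrite !memb /=; lia.
    rewrite leqNgt; apply/negP => lt.
    have c1 : (k.+1, (f k).+1) \in x :: s by rewrite memb /= ltnSn; have := g_decr k; lia.
    have c2 : (k.+2, (f k).+2) \in x :: s by rewrite memb /= lt andbT; have := f_decr k; lia.
    have [] : (k.+1, (f k).+1) = (k.+2, (f k).+2); last by lia.
    by apply: (ribbon_path_content_inj srt c1 c2) => /=; lia.
  apply/eqP; rewrite eqn_leq fg andbT leqNgt; apply/negP => lt.
  have : (k.+1, g k) \in x :: s by rewrite memb /= lt leqnn.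
  by move=> /rows /=; lia.
split=> //; have [fg0 fgS _] := bs.
have [_ _ <-] := border_sorted f_decr fg0 fgS; congr (_ + _)%N.
rewrite -sb; apply: perm_size; apply: uniq_perm => //; first exact: border_uniq.
move=> c; have := border_strip_skew bs; rewrite bE => /fsetP/(_ c).
by rewrite !in_fset.
Qed.

End Ribbons.

Section Moves.

Variables (l : seq nat) (r n : nat).
Hypotheses (pl : is_part l) (r0 : (0 < r)%N) (ln : (size l + r <= n)%N).
Let f := nth 0%N l.
Let f_decr k : (f k.+1 <= f k)%N. Proof. exact/sorted_geqP/part_sorted. Qed.
Let f_decr2 i j : (i <= j)%N -> (f j <= f i)%N.
Proof. exact/sorted_geq_nth/part_sorted. Qed.

(** The pair (i, i0) stands for advancing bead [i] by [r] to a place strictly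
    between the beads [i0] and [i0 - 1], so that it becomes bead [i0] after
    sorting. The inequalities between positions are written with row lengths. *)
Definition legal_move (p : nat * nat) : bool :=
  (nth 0 l p.2 + (p.1 - p.2) < nth 0 l p.1 + r)%N &&
  ((p.2 == 0) || (nth 0 l p.1 + r <= nth 0 l p.2.-1 + (p.1 - p.2)))%N.

Definition legal_moves : seq (nat * nat) :=
  [seq p <- [seq (i, i0) | i <- iota 0 n, i0 <- iota 0 i.+1] | legal_move p].

(** The row lengths after the move: the beads [i0, ..., i - 1] keep their positions
    but go down one row, so that these rows get one box longer. *)
Definition moved (p : nat * nat) k : nat :=
  if k == p.2 then (nth 0 l p.1 + r - (p.1 - p.2))%N
  else if (p.2 < k <= p.1)%N then (nth 0 l k.-1).+1 else nth 0%N l k.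

Definition move_ribbon p : seq nat := trim (mkseq (moved p) n).

Definition ribbons : seq (seq nat) := map move_ribbon legal_moves.

Lemma mem_legal_moves i i0 :
  ((i, i0) \in legal_moves) = [&& i < n, i0 <= i & legal_move (i, i0)]%N.
Proof.
rewrite mem_filter andbC andbA; congr (_ && _).
apply/allpairsPdep/idP => [[j [j0 [jI j0I [-> ->]]]]|].
  by move: jI j0I; rewrite !mem_iota; lia.
by move=> iI; exists i, i0; rewrite !mem_iota; split=> //; lia.
Qed.

Lemma legal_moves_uniq : uniq legal_moves.
Proof.
apply: filter_uniq; apply: allpairs_uniq_dep => [|i _|]; try exact: iota_uniq.
by move=> [i i0] [j j0] _ _ /= [-> ->].
Qed.

Section OneMove.

Variables (i i0 : nat).
Hypothesis ii0 : (i, i0) \in legal_moves.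

Lemma legal_movesE : [/\ (i < n)%N, (i0 <= i)%N, (f i0 + (i - i0) < f i + r)%N
   & i0 = 0%N \/ (0 < i0)%N /\ (f i + r <= f i0.-1 + (i - i0))%N].
Proof.
move: ii0; rewrite mem_legal_moves => /and3P[i_n i0i /andP[/= H1 H2]].
split=> //; case/orP: H2 => [/eqP ->|H2]; first by left.
by case: (posnP i0) => ?; [left|right].
Qed.

Lemma moved_decr : sorted geq (mkseq (moved (i, i0)) n).
Proof.
have [i_n i0i lt le] := legal_movesE.
apply/(sortedP 0%N) => k; rewrite size_mkseq => kn.
rewrite !nth_mkseq ?(ltnW kn)// /moved /= -/f.
have fk := f_decr k; have fk1 := f_decr k.-1.
have [ki0|ki0] := eqVneq k i0.
  rewrite ki0 in kn fk fk1 *; rewrite (_ : (i0.+1 == i0) = false); last lia.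
  by case: ifP => /= kI; lia.
have [kSi0|kSi0] := eqVneq k.+1 i0.
  rewrite ifF; last lia.
  by case: le => [|[_]]; rewrite -?kSi0 /=; lia.
have kk : (0 < k)%N -> k.-1.+1 = k by lia.
case: ifP => k1; case: ifP => k2 /=; try lia.
  by rewrite kk in fk1; lia.
have -> : k = i by lia.
have i0i' : (i0 < i)%N by lia.
by have := f_decr i; have := f_decr i.-1; rewrite prednK; lia.
Qed.

Lemma nth_move_ribbon : nth 0%N (move_ribbon (i, i0)) =1 moved (i, i0).
Proof.
have [i_n i0i _ _] := legal_movesE.
move=> k; rewrite nth_trim ?moved_decr//.
have [kn|nk] := ltnP k n; first by rewrite nth_mkseq.
rewrite nth_default ?size_mkseq// /moved /= ifF; last lia.
by rewrite ifF ?nth_default//; lia.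
Qed.

Lemma move_ribbon_part : is_part (move_ribbon (i, i0)).
Proof. exact/trim_part/moved_decr. Qed.

Lemma move_border : border_strip f (nth 0%N (move_ribbon (i, i0))) i0 (i - i0).
Proof.
have [i_n i0i lt le] := legal_movesE; split.
- by rewrite nth_move_ribbon /moved eqxx /= -/f; lia.
- move=> k kI; rewrite nth_move_ribbon /moved /= ifF; last lia.
  by rewrite ifT//; lia.
- by move=> k kI; rewrite nth_move_ribbon /moved /= ifF ?ifF//; lia.
Qed.

End OneMove.

(** A border strip in the rows [i0, ..., i] is the move (i, i0). The assumption on
    [n] leaves enough rows for all the ribbons. *)
Lemma mem_ribbons nu : reflect (is_part nu /\ adds_ribbon r l nu) (nu \in ribbons).
Proof.
apply: (iffP mapP) => [[[i i0] ii0 ->]|[pnu adds]].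
  have [i_n i0i lt le] := legal_movesE ii0; split; first exact: move_ribbon_part.
  apply: (border_strip_adds (part_sorted pl) _ (move_border ii0)).
    exact/part_sorted/move_ribbon_part.
  by rewrite nth_move_ribbon// /moved eqxx /= -/f subnKC//; lia.
have [i0 [m [bs rE]]] := adds_ribbon_border (part_sorted pl) (part_sorted pnu) r0 adds.
have [fg0 fgS fgE] := bs.
have g_decr : forall k, (nth 0 nu k.+1 <= nth 0 nu k)%N.
  exact/sorted_geqP/part_sorted.
have prev : i0 = 0%N \/ (0 < i0)%N /\ (nth 0 nu i0 <= f i0.-1)%N.
  case: (posnP i0) => i0P; first by left.
  right; split=> //; rewrite /f -fgE; last lia.
  by have := g_decr i0.-1; rewrite prednK.
have i_n : (i0 + m < n)%N.
  rewrite ltnNge; apply/negP => nm.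
  have fim : nth 0%N l (i0 + m) = 0%N by rewrite nth_default//; lia.
  case: prev => [i00|[i0P]]; first by lia.
  have [li|il] := leqP (size l) i0.-1; first by rewrite /f (nth_default _ li); lia.
  lia.
have ii0 : ((i0 + m)%N, i0) \in legal_moves.
  rewrite mem_legal_moves /legal_move i_n leq_addr /= addKn; rewrite /f in fg0 prev.
  apply/andP; split; first by lia.
  by case: prev => [->//|[_ ?]]; apply/orP; right; lia.
exists ((i0 + m)%N, i0) => //; apply: part_ext => //; first exact: move_ribbon_part.
move=> k; rewrite nth_move_ribbon// /moved /= addKn.
have [->|ki0] := eqVneq k i0; first by lia.
case: ifP => kI; last by rewrite fgE//; lia.
by have := fgS k.-1; rewrite prednK; [apply; lia|lia].
Qed.

Lemma ribbons_uniq : uniq ribbons.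
Proof.
rewrite map_inj_in_uniq ?legal_moves_uniq// => -[i i0] [j j0] ii0 jj0 E.
have bi := move_border ii0; have bj := move_border jj0; rewrite -E in bj.
have [_ i0i _ _] := legal_movesE ii0; have [_ j0j _ _] := legal_movesE jj0.
have H k : (i0 <= k <= i)%N = (j0 <= k <= j)%N.
  rewrite -(subnKC i0i) -(subnKC j0j) -(border_strip_ltE f_decr k bi).
  by rewrite -(border_strip_ltE f_decr k bj).
have := H i; have := H i0; have := H j; have := H j0.
by rewrite !leqnn ?i0i ?j0j ?andbT /= => *; congr (_, _); lia.
Qed.

Lemma ribbon_sgn_move i i0 : (i, i0) \in legal_moves ->
  ribbon_sgn (dg (move_ribbon (i, i0)) `\` dg l)%fset = (-1) ^+ (i - i0).
Proof.
move=> ii0; apply: (border_strip_sgn (part_sorted pl) _ (move_border ii0)).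
exact/part_sorted/move_ribbon_part.
Qed.

Section Straighten.

Variables (R : comNzRingType) (n' : nat) (G : {ffun 'I_n' -> nat} -> R).
Hypotheses (tf : forall h : R, h *+ 2 = 0 -> h = 0) (altG : alternating G).

Let a k := (f k + (n'.-1 - k))%N.

(** The beads with bead [i], advanced by [r], inserted before [t, ..., i - 1]:
    the stages of sorting by adjacent exchanges. *)
Definition inserted i t : {ffun 'I_n' -> nat} :=
  [ffun k : 'I_n' => if k == t :> nat then (a i + r)%N
                    else if (t < k <= i)%N then a k.-1 else a k].

Lemma straighten i t : (i < n')%N -> (t <= i)%N ->
  G (inserted i i) = (-1) ^+ (i - t) * G (inserted i t).
Proof.
move=> i_n ti; rewrite -(subKn ti); move: (leq_subr t i); move: (i - t)%N => m.
elim: m => [|m IH] mi; first by rewrite subn0 subnn expr0 mul1r.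
rewrite (IH (ltnW mi)) !subKn//; last exact: ltnW.
have s1 : (i - m.+1 < n')%N by lia.
have s2 : (i - m < n')%N by lia.
have neq : Ordinal s1 != Ordinal s2 by rewrite -val_eqE /=; lia.
have -> : inserted i (i - m) = swap (Ordinal s1) (Ordinal s2) (inserted i (i - m.+1)).
  apply: eq_vec => k; rewrite swapE !ffunE.
  case: tpermP => [->|->|/eqP k1 /eqP k2]; rewrite -?val_eqE /=.
  - rewrite ifF; last lia.
    rewrite ifF; last lia.
    rewrite ifF; last lia.
    by rewrite ifT; [congr a; lia|lia].
  - by rewrite !eqxx.
  - move: k1 k2; rewrite -!val_eqE /= => k1 k2.
    rewrite (negPf k1) (negPf k2).
    by rewrite (_ : (i - m < k <= i)%N = (i - m.+1 < k <= i)%N)//; lia.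
by rewrite altG// exprS mulrN mulN1r mulNr.
Qed.

Lemma bump_inserted (i : 'I_n') : bump_at r i (beta n' l) = inserted i i.
Proof.
apply: eq_vec => k; rewrite bump_atE betaE ffunE -val_eqE /= /a.
case: eqP => [->//|_]; rewrite ifF//; lia.
Qed.

Lemma inserted_move i i0 : (i < n')%N -> (i, i0) \in legal_moves ->
  inserted i i0 = beta n' (move_ribbon (i, i0)).
Proof.
move=> i_n ii0; have [_ i0i lt _] := legal_movesE ii0.
apply: eq_vec => k; rewrite betaE nth_move_ribbon// ffunE /moved /= /a -/f.
have := ltn_ord k; case: eqP => [->|_]; first by lia.
by case: ifP => //; lia.
Qed.

Lemma move_uniq i i0 j0 : (i, i0) \in legal_moves -> (i, j0) \in legal_moves -> i0 = j0.
Proof.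
move=> H H'; have [_ i0i lt le] := legal_movesE H; have [_ j0i lt' le'] := legal_movesE H'.
have [ij|ji|//] := ltngtP i0 j0.
- have := @f_decr2 i0 j0.-1; case: le' => [|[_ ?]]; lia.
- have := @f_decr2 j0 i0.-1; case: le => [|[_ ?]]; lia.
Qed.

(** The advanced bead [i] either lands strictly between two beads or on another
    bead; in the latter case an antisymmetric function vanishes. *)
Lemma move_or_collision i :
  (exists i0, (i, i0) \in legal_moves) \/
  (exists2 k, (k < i)%N & (f k + (i - k) = f i + r)%N).
Proof.
have [i_n|ni] := ltnP i n; last first.
  right; exists (i - r)%N; first by lia.
  by rewrite /f !nth_default; lia.
(* Row [i0] is the first one whose bead is below the landing place. *)
pose P i0 := (i0 <= i)%N && (f i0 + (i - i0) < f i + r)%N.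
have exP : exists i0, P i0 by exists i; rewrite /P leqnn subnn addn0; lia.
have [i0 /andP[i0i lt] min] := ex_minnP exP.
have [i00|i0P] := posnP i0.
  by left; exists i0; rewrite mem_legal_moves /legal_move /= i_n i0i lt i00.
have [le|gt] := leqP (f i + r) (f i0.-1 + (i - i0)).
  by left; exists i0; rewrite mem_legal_moves /legal_move /= i_n i0i lt le orbT.
have : ~~ P i0.-1 by apply/negP => /min; lia.
rewrite /P negb_and => nP; right; exists i0.-1; first by lia.
by move: nP; rewrite -/f; lia.
Qed.

Lemma bump_straighten (i : 'I_n') :
  G (bump_at r i (beta n' l)) =
  \sum_(p <- legal_moves | p.1 == i) (-1) ^+ (p.1 - p.2) * G (beta n' (move_ribbon p)).
Proof.
have [[i0 ii0]|[k ki kE]] := move_or_collision i.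
  have [i_n i0i lt le] := legal_movesE ii0.
  rewrite -big_filter (_ : [seq p <- legal_moves | p.1 == i :> nat] = [:: (nat_of_ord i, i0)]).
    rewrite big_seq1 bump_inserted (@straighten i i0)// inserted_move//.
  apply: perm_small_eq => //; apply: uniq_perm => //; first exact/filter_uniq/legal_moves_uniq.
  move=> [j j0]; rewrite mem_filter inE /=; apply/andP/eqP => [[/eqP -> jj0]|[-> ->]].
    by congr (_, _); apply: move_uniq jj0 ii0.
  by rewrite eqxx.
have kn : (k < n')%N by apply: ltn_trans (ltn_ord i).
have ki' : Ordinal kn != i by rewrite -val_eqE /=; lia.
rewrite big_seq_cond big1; last first.
  move=> [j i0] /andP[/= ii0 /eqP ji]; rewrite ji in ii0.
  have [_ i0i lt le] := legal_movesE ii0.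
  have ki0 : (k < i0)%N.
    by rewrite ltnNge; apply/negP => i0k; have := f_decr2 i0k; lia.
  by have := @f_decr2 k i0.-1; case: le => [|[_ ?]]; lia.
apply: (alternating_dup tf altG ki'); rewrite !bump_atE !betaE (negPf ki') eqxx /= -/f.
by have := ltn_ord i; lia.
Qed.

(** Sorting the advanced beads turns the sum over the beads into a signed sum over
    the ribbons. *)
Lemma sum_bump_moves : (n <= n')%N ->
  \sum_(i < n') G (bump_at r i (beta n' l)) =
  \sum_(p <- legal_moves) (-1) ^+ (p.1 - p.2) * G (beta n' (move_ribbon p)).
Proof.
move=> nn'; under eq_bigr do rewrite bump_straighten.
under eq_bigr do rewrite big_mkcond.
rewrite exchange_big /=; apply: eq_big_seq => -[i i0] ii0 /=.
have [i_n _ _ _] := legal_movesE ii0.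
rewrite (bigD1 (Ordinal (leq_trans i_n nn')))//= eqxx big1 ?addr0// => j.
by rewrite -val_eqE /= eq_sym => /negPf ->.
Qed.

End Straighten.

End Moves.

(** * Schur series and power sums *)

(** Replaces a sum over a possibly infinite set by a finite sum over a list that
    contains the support. *)
Lemma fsbig_list (T : choiceType) (V : nmodType) (A : set T) (s : seq T) (F : T -> V) :
    uniq s -> {in s, forall t, A t} -> (forall t, A t -> t \notin s -> F t = 0) ->
  \sum_(t \in A) F t = \sum_(t <- s) F t.
Proof.
move=> us sA AF; rewrite (fsbig_seq _ _ us); apply/esym/fsbig_widen.
  by move=> t /=; exact: sA.
by move=> t [At /= /negP]; exact: AF.
Qed.

Lemma pseries_sum (I : Type) (s : seq I) (P : pred I) (F : I -> pseries) M :
  (\sum_(i <- s | P i) F i) M = \sum_(i <- s | P i) F i M.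
Proof. by elim/big_rec2: _ => // i y f _ <-. Qed.

Lemma pseries_muln (f : pseries) n M : (f *+ n) M = f M *+ n.
Proof. by elim: n => // n IH; rewrite !mulrS -IH. Qed.

Lemma pseries_scale c (f : pseries) M : (c *: f) M = c * f M.
Proof. by []. Qed.

Lemma pseries_mul (f g : pseries) M : (f * g) M = \sum_(p \in splits M) f p.1 * g p.2.
Proof. by []. Qed.

Lemma pseries_torsion_free (f : pseries) : f *+ 2 = 0 -> f = 0.
Proof.
move=> f2; apply/funext => M; apply/eqP.
have := congr1 (fun h : pseries => h M) f2; rewrite pseries_muln => /eqP.
by rewrite -mulr_natr mulf_eq0 => /orP[].
Qed.

Lemma scale_mulr c (f g : pseries) : f * (c *: g) = c *: (f * g).
Proof.
apply/funext => M; rewrite pseries_scale !pseries_mul.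
rewrite !(fsbig_finite _ _ (finite_splits M)) mulr_sumr /=.
by apply: eq_bigr => p _; rewrite pseries_scale mulrCA.
Qed.

Lemma scale_mull c (f g : pseries) : (c *: f) * g = c *: (f * g).
Proof. by rewrite mulrC scale_mulr mulrC. Qed.

(** A coefficient of a product depends only on the coefficients of the factors at
    the divisors of the monomial, so the factors may be truncated. *)
Lemma eq_pseries_mul (f f' g g' : pseries) M :
    (forall A, (A `<=` M)%mset -> f A = f' A) ->
    (forall A, (A `<=` M)%mset -> g A = g' A) ->
  (f * g) M = (f' * g') M.
Proof.
move=> ff' gg'; rewrite !pseries_mul; apply: eq_fsbigr => -[A B]; rewrite inE /= => AB.
by congr (_ * _); [apply: ff'|apply: gg']; rewrite -AB; apply/msubsetP => v;
  rewrite msetE2 ?leq_addr ?leq_addl.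
Qed.

HB.lock Definition mono (A : monom) : pseries := fun M => (M == A)%:R.

Lemma monoE A M : mono A M = (M == A)%:R.
Proof. by rewrite mono.unlock. Qed.

Lemma monoM A B : mono A * mono B = mono (A `+` B)%mset.
Proof.
apply/funext => M; rewrite pseries_mul monoE.
under eq_fsbigr do rewrite !monoE.
have [->|MAB] := eqVneq M (A `+` B)%mset.
  rewrite (@fsbig_list _ _ _ [:: (A, B)]) //.
  - by rewrite big_seq1 !eqxx mulr1.
  - by move=> p; rewrite inE => /eqP ->.
  move=> [A' B'] _; rewrite inE xpair_eqE negb_and /=.
  by case/orP => /negPf ->; rewrite ?mul0r ?mulr0.
rewrite fsbig1// => -[A' B'] /= AB; have [AA|] := eqVneq A' A; last by rewrite mul0r.
have [BB|] := eqVneq B' B; last by rewrite mulr0.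
by rewrite -AA -BB AB eqxx in MAB.
Qed.

Lemma mono1 : mono mset0 = 1.
Proof. by rewrite mono.unlock. Qed.

Lemma XE v : X v = mono [mset v]%mset.
Proof. by rewrite mono.unlock. Qed.

Lemma prod_X (s : seq pvar) : \prod_(v <- s) X v = mono (seq_mset s).
Proof.
elim: s => [|v s IH].
  rewrite big_nil -mono1; congr mono; apply/esym/eqP.
  by rewrite -size_mset_eq0 (perm_size (perm_eq_seq_mset _)).
by rewrite big_cons IH XE monoM mset_cons.
Qed.

Definition mpow m (A : monom) : monom := iter m (msetD A) mset0.

Lemma mpowE m A v : mpow m A v = (m * A v)%N.
Proof. by elim: m => [|m IH]; rewrite /mpow /= ?mset0E// msetE2 IH mulSn. Qed.

Lemma mpowM m e A : mpow m (mpow e A) = mpow (e * m) A.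
Proof. by apply/msetP => v; rewrite !mpowE mulnCA mulnA. Qed.

Lemma mpow_inj m : (0 < m)%N -> injective (mpow m).
Proof.
move=> m0 A B /msetP AB; apply/msetP => v; have /eqP := AB v.
by rewrite !mpowE eqn_pmul2l// => /eqP.
Qed.

Lemma X_pow v e : X v ^+ e = mono (mpow e [mset v]%mset).
Proof.
elim: e => [|e IH]; first by rewrite expr0 -mono1.
by rewrite exprS IH XE monoM.
Qed.

Definition psum k r : pseries :=
  fsum [set j | (0 < j)%N] (fun j => X (k, j) ^+ r).

Definition var k j : pseries := X (k, j.+1).

Definition vars_below N k (M : monom) : Prop := forall j, (k, j) \in M -> (j <= N)%N.

Lemma vars_below_sub N k A M : (A `<=` M)%mset -> vars_below N k M -> vars_below N k A.
Proof.
move=> AM MN j jA; apply: MN; move: jA; rewrite !in_mset => jA.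
exact: leq_trans jA (msubsetP AM _).
Qed.

Lemma psum_truncate k r N M : (0 < r)%N -> vars_below N k M ->
  psum k r M = (\sum_(j < N) var k j ^+ r) M.
Proof.
move=> r0 MN; rewrite pseries_sum -(big_mkord predT (fun j => (var k j ^+ r) M)).
have -> : \sum_(0 <= j < N) (var k j ^+ r) M = \sum_(j <- iota 1 N) (X (k, j) ^+ r) M.
  by rewrite /index_iota subn0 -[1%N]addn0 iotaDl big_map.
apply: fsbig_list; first exact: iota_uniq.
  by move=> j; rewrite mem_iota /= => /andP[].
move=> j /= j0; rewrite mem_iota X_pow monoE; case: eqP => // ME.
have : (j <= N)%N by apply: MN; rewrite ME in_mset mpowE msetnxx muln1.
by move=> jN; rewrite j0 add1n ltnS jN.
Qed.

Lemma tab_weight_mono k (T : seq (seq nat)) :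
  \prod_(row <- T) \prod_(j <- row) X (k, j) =
  mono (seq_mset [seq (k, j) | j <- flatten T]).
Proof. by rewrite -prod_X big_map big_flatten. Qed.

Lemma tab_weight_var k l T : is_ssyt l T ->
  tab_weight (var k) T = \prod_(row <- T) \prod_(j <- row) X (k, j).
Proof.
case=> _ T0 _ _; apply: eq_big_seq => row rT; apply: eq_big_seq => j jr.
by rewrite /var prednK//; exact: (allP (allP T0 _ rT)).
Qed.

(** The tableaux that contribute to the coefficient of a monomial have entries
    among the indices of its variables. *)
Lemma schur_truncate k l N M : sorted geq l -> vars_below N k M ->
  schur k l M = (\sum_(T <- tabs N l) tab_weight (var k) T) M.
Proof.
move=> sl MN; rewrite pseries_sum /schur /fsum.
rewrite (@fsbig_list _ _ _ (tabs N l)); first 1 last.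
- exact: tabs_uniq.
- by move=> T /(mem_tabs _ _ sl)[].
- move=> T /= Tssyt TN; rewrite tab_weight_mono monoE; case: eqP => // ME.
  case/negP: TN; apply/(mem_tabs _ _ sl); split=> //.
  apply/allP => row rT; apply/allP => j jr; apply: MN; rewrite ME.
  rewrite (perm_mem (perm_eq_seq_mset _)); apply/mapP; exists j => //.
  by apply/flattenP; exists row.
by apply: eq_big_seq => T /(mem_tabs _ _ sl)[Tssyt _]; rewrite (tab_weight_var _ Tssyt).
Qed.

Lemma ssyt_pad d l T : is_ssyt (l ++ nseq d 0%N) T <->
  exists2 T0, is_ssyt l T0 & T = T0 ++ nseq d [::].
Proof.
split=> [Tssyt|[T0 T0ssyt ->]].
  have Tsize := ssyt_size Tssyt; have Trow i := @ssyt_row _ _ i Tssyt.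
  have [Tl T0 Ts Tc] := Tssyt; rewrite size_cat size_nseq in Tsize.
  exists (take (size l) T).
    split; first by rewrite /shape map_take -/(shape T) Tl take_size_cat.
    - by move: T0; rewrite -{1}[T](cat_take_drop (size l)) all_cat => /andP[].
    - by move: Ts; rewrite -{1}[T](cat_take_drop (size l)) all_cat => /andP[].
    move=> i j; rewrite size_take_min leq_min => /andP[il iT].
    rewrite !nth_take//; last exact: ltnW.
    exact: Tc.
  rewrite -{1}[T](cat_take_drop (size l)); congr (_ ++ _).
  rewrite (_ : d = size (drop (size l) T)); last by rewrite size_drop Tsize addKn.
  apply/all_pred1P/(all_nthP [::]) => i _; rewrite nth_drop /= -size_eq0 Trow.
  by rewrite nth_cat ltnNge leq_addr /= nth_nseq if_same.
have [Tl T0p Ts Tc] := T0ssyt; split.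
- by rewrite /shape map_cat map_nseq -/(shape T0) Tl.
- by rewrite all_cat T0p all_nseq orbT.
- by rewrite all_cat Ts all_nseq orbT.
move=> i j iT; rewrite !nth_cat; case: (ltnP i.+1) => iT0; last first.
  by rewrite nth_nseq if_same.
by rewrite (ltnW iT0); exact: Tc.
Qed.

Lemma sum_tabs (R : comNzRingType) (x : nat -> R) n N l :
    (forall h : R, h *+ 2 = 0 -> h = 0) -> is_part l -> (size l <= n)%N ->
  \sum_(T <- tabs N l) tab_weight x T = alt_schur x N (beta n l).
Proof.
move=> tf pl ln; have sl := part_sorted pl.
pose l' := l ++ nseq (n - size l) 0%N.
have l'E i : nth 0%N l' i = nth 0%N l i.
  by rewrite nth_cat; case: ltnP => // li; rewrite nth_nseq if_same nth_default.
have sl' : sorted geq l' by apply/sorted_geqP => i; rewrite !l'E sorted_geq_nth.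
have -> : beta n l = beta n l' by apply: eq_vec => i; rewrite !betaE l'E.
rewrite -(sum_tabs_rows x tf)//; last by rewrite size_cat size_nseq subnKC.
have -> : \sum_(T <- tabs N l') tab_weight x T =
    \sum_(T <- map (cat^~ (nseq (n - size l) [::])) (tabs N l)) tab_weight x T.
  apply: perm_big; apply: uniq_perm; first exact: tabs_uniq.
    rewrite map_inj_in_uniq ?tabs_uniq// => T T' Tl T'l /eqP.
    have [Tssyt _] := mem_tabs _ _ sl Tl; have [T'ssyt _] := mem_tabs _ _ sl T'l.
    by rewrite eqseq_cat ?(ssyt_size Tssyt) ?(ssyt_size T'ssyt)// => /andP[/eqP].
  move=> T; apply/(mem_tabs _ _ sl')/mapP => [[/ssyt_pad[T0 T0ssyt ->]]|].
    rewrite /bounded all_cat => /andP[T0N _]; exists T0 => //.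
    exact/(mem_tabs _ _ sl).
  move=> [T0 /(mem_tabs _ _ sl)[T0ssyt T0N] ->]; split.
    by apply/ssyt_pad; exists T0.
  by rewrite /bounded all_cat all_nseq orbT andbT.
rewrite big_map; apply: eq_bigr => T _.
by rewrite /tab_weight big_cat /= big_nseq big_nil iter_mulr_1 expr1n mulr1.
Qed.

(** At a given monomial, the Schur functions and the power sum may be truncated to
    [N] variables, where [alt_schur_bump] and [sum_bump_moves] apply. *)
Theorem murnaghan_nakayama k l r : is_part l -> (0 < r)%N ->
  schur k l * psum k r =
  \sum_(nu <- ribbons l r (size l + r)) ribbon_sgn (dg nu `\` dg l)%fset *: schur k nu.
Proof.
move=> pl r0; have sl := part_sorted pl; apply/funext => M.
pose N := (\max_(v <- M) v.2)%N.
have MN : vars_below N k M.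
  move=> j; rewrite in_mset -count_mem_mset -has_count has_pred1 => jM.
  by rewrite /N (big_rem _ jM) /= leq_maxl.
(* At least [size l + r] rows, for all the ribbons to fit, and more than [N]. *)
pose n := (size l + r + N.+1)%N.
pose S nu := \sum_(T <- tabs N nu) tab_weight (var k) T.
have SE nu : is_part nu -> (size nu <= n)%N -> S nu = alt_schur (var k) N (beta n nu).
  by move=> pnu nun; exact: (sum_tabs _ _ pseries_torsion_free).
have -> : (schur k l * psum k r) M = (S l * \sum_(j < N) var k j ^+ r) M.
  apply: eq_pseries_mul => A AM; have AN := vars_below_sub AM MN.
    exact: schur_truncate.
  exact: psum_truncate.
rewrite SE//; last by rewrite /n -addnA leq_addr.
rewrite mulrC -(alt_schur_bump pseries_torsion_free) //; last by rewrite /n; lia.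
have alt := @alternating_alt_schur _ n (var k) N.
rewrite (sum_bump_moves pl r0 (leqnn _) pseries_torsion_free alt) ?leq_addr//.
rewrite !pseries_sum /ribbons big_map; apply: eq_big_seq => -[i i0] ii0 /=.
have pnu := move_ribbon_part pl r0 (leqnn _) ii0.
have nun : (size (move_ribbon l r (size l + r) (i, i0)) <= n)%N.
  by rewrite size_filter (leq_trans (count_size _ _))// size_mkseq leq_addr.
rewrite (ribbon_sgn_move pl r0 (leqnn _) ii0) pseries_scale (schur_truncate (part_sorted pnu) MN).
rewrite -/(S _) SE// -[(-1) ^+ _ in LHS]signr_odd mulr_sign -signr_odd.
by case: odd; rewrite ?mulN1r ?mul1r.
Qed.

Lemma subst_pow_mpow m f A : (0 < m)%N -> subst_pow m f (mpow m A) = f A.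
Proof.
move=> m0; rewrite /subst_pow (@fsbig_list _ _ _ [:: A]) ?big_seq1//.
  by move=> B; rewrite inE => /eqP ->.
by move=> B /= /(mpow_inj m0) ->; rewrite inE eqxx.
Qed.

Lemma subst_pow_not_mpow m f M : (forall A, mpow m A <> M) -> subst_pow m f M = 0.
Proof. by move=> H; rewrite /subst_pow fsbig1// => A /H. Qed.

(** Taking m-th powers of monomials is injective, so that no coefficients are
    merged by the substitution. *)
Lemma psum_subst k e m : (0 < m)%N -> (0 < e)%N -> subst_pow m (psum k e) = psum k (e * m).
Proof.
move=> m0 e0; apply/funext => M.
have XE j : X (k, j) ^+ (e * m) = mono (mpow m (mpow e [mset (k, j)]%mset)).
  by rewrite X_pow mpowM.
have [[A <-]|nA] := pselect (exists A, mpow m A = M).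
  rewrite subst_pow_mpow// /psum /fsum; apply: eq_fsbigr => j _.
  by rewrite XE X_pow !monoE (inj_eq (mpow_inj m0)).
rewrite subst_pow_not_mpow => [|A AM]; last by apply: nA; exists A.
rewrite /psum /fsum fsbig1// => j _; rewrite XE monoE; case: eqP => // ME.
by case: nA; exists (mpow e [mset (k, j)]%mset).
Qed.

Lemma P_blockE d m : (0 < d)%N -> (0 < m)%N ->
  P_block (d, m) = \sum_(k <- divisors d) psum k (d * m %/ k) *+ k.
Proof.
move=> d0 m0; have -> : P_block (d, m) =
    \sum_(k <- divisors d) subst_pow m (psum k (d %/ k)) *+ k.
  apply/funext => M; rewrite /P_block /power_sum /= -/(psum _ _).
  have [[A <-]|nA] := pselect (exists A, mpow m A = M).
    rewrite subst_pow_mpow// !pseries_sum; apply: eq_bigr => k _.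
    by rewrite !pseries_muln subst_pow_mpow.
  have nA' A : mpow m A <> M by move=> AM; apply: nA; exists A.
  rewrite subst_pow_not_mpow// pseries_sum big1// => k _.
  by rewrite pseries_muln subst_pow_not_mpow// mul0rn.
apply: eq_big_seq => k; rewrite -dvdn_divisors// => kd.
rewrite psum_subst//; first by rewrite divn_mulAC.
by rewrite divn_gt0 ?(dvdn_leq d0)// (dvdn_gt0 d0).
Qed.

(** * Types and tensor rim hook tableaux *)

Lemma block_ge_trans : transitive block_ge.
Proof. by move=> [b1 b2] [a1 a2] [c1 c2]; rewrite /block_ge /=; lia. Qed.

Lemma block_ge_total : total block_ge.
Proof. by move=> [a1 a2] [b1 b2]; rewrite /block_ge /=; lia. Qed.

Lemma block_ge_anti : antisymmetric block_ge.
Proof. by move=> [a1 a2] [b1 b2]; rewrite /block_ge /= => H; congr (_, _); lia. Qed.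

Lemma geq_anti : antisymmetric geq.
Proof. by move=> a b /=; lia. Qed.

Lemma component_part tau k : is_type tau -> is_part (component tau k).
Proof.
move=> /andP[bl srt]; apply/andP; split; last first.
  apply/allP => m /mapP[b]; rewrite mem_filter => /andP[_ btau] ->.
  by have /andP[] := allP bl b btau.
rewrite /component.
apply: (@homo_sorted_in _ _ (fun b : block => b.1 == k) snd block_ge).
- move=> [b1 b2] [c1 c2]; rewrite /in_mem /block_ge /= => /eqP -> /eqP ->.
  by rewrite ltnn eqxx.
- exact: filter_all.
- exact: sorted_filter block_ge_trans _ _ srt.
Qed.

Lemma count_component tau (b : block) :
  count_mem b tau = count_mem b.2 (component tau b.1).
Proof.
case: b => k m; rewrite /component count_map count_filter; apply: eq_count => -[k' m'].
by rewrite /= xpair_eqE andbC.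
Qed.

(** The multiplicity of a block in a type can be read off a component, and a sorted
    sequence is determined by its multiplicities. *)
Lemma type_ext tau tau' : is_type tau -> is_type tau' ->
  component tau =1 component tau' -> tau = tau'.
Proof.
move=> /andP[_ st] /andP[_ st'] E.
apply: (sorted_eq block_ge_trans block_ge_anti) => //.
by apply/allP => b _ /=; rewrite !count_component E.
Qed.

Definition set_component (tau : seq block) k (nu : seq nat) : seq block :=
  sort block_ge ([seq b <- tau | b.1 != k] ++ [seq (k, m) | m <- nu]).

Section SetComponent.

Variables (tau : seq block) (k : nat) (nu : seq nat).
Hypotheses (htau : is_type tau) (k0 : (0 < k)%N) (pnu : is_part nu).

Lemma set_component_type : is_type (set_component tau k nu).
Proof.
apply/andP; split; last exact: sort_sorted block_ge_total _.
rewrite all_sort all_cat; apply/andP; split.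
  apply/allP => b; rewrite mem_filter => /andP[_ btau].
  by case/andP: htau => /allP bl _; exact: bl.
by rewrite all_map; case/andP: pnu => _; apply: sub_all => m /= m0; rewrite /is_block /= k0.
Qed.

Lemma component_set l :
  component (set_component tau k nu) l = if l == k then nu else component tau l.
Proof.
have part_if : is_part (if l == k then nu else component tau l).
  by case: eqP => // _; exact: component_part.
apply: (sorted_eq geq_trans geq_anti).
- exact/part_sorted/component_part/set_component_type.
- exact: part_sorted.
have -> : (if l == k then nu else component tau l) =
    component ([seq b <- tau | b.1 != k] ++ [seq (k, m) | m <- nu]) l.
  rewrite /component filter_cat map_cat -filter_predI filter_map -map_comp.
  case: eqP => [->|lk].
    rewrite (@eq_filter _ (predI _ _) pred0) ?filter_pred0/=; last by move=> b /=; case: eqP.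
    rewrite (@eq_filter _ _ predT) ?filter_predT ?map_id//.
    by move=> m /=; rewrite eqxx.
  rewrite (@eq_filter _ (predI _ _) (fun b : block => b.1 == l)); last first.
    by move=> b /=; case: eqP => // ->; apply/eqP.
  rewrite (@eq_filter _ (preim _ _) pred0) ?filter_pred0 ?cats0//.
  by move=> m /=; apply/eqP => kl; case: lk.
by apply: perm_map; apply: perm_filter; rewrite perm_sort.
Qed.

Lemma max_deg_set K : (max_deg tau <= K)%N -> (k <= K)%N ->
  (max_deg (set_component tau k nu) <= K)%N.
Proof.
move=> tK kK; apply/bigmax_leqP_seq => b; rewrite mem_sort mem_cat => /orP[|/mapP[m _ ->]//].
rewrite mem_filter => /andP[_ btau] _; apply: leq_trans tK.
by rewrite /max_deg; apply: (leq_bigmax_seq (F := fst)).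
Qed.

End SetComponent.

Lemma schur_nil k : schur k [::] = 1.
Proof.
apply/funext => M; rewrite /schur /fsum (@fsbig_list _ _ _ [:: [::]])//.
- by rewrite big_seq1 big_nil.
- by move=> T; rewrite inE => /eqP -> /=; split.
by move=> T [T0 _ _ _]; rewrite inE; case: T T0.
Qed.

Lemma component_default tau k : (max_deg tau < k)%N -> component tau k = [::].
Proof.
move=> tk; rewrite /component (@eq_in_filter _ _ pred0) ?filter_pred0// => b btau.
apply/eqP => bk; move: tk; rewrite ltnNge -bk => /negP; apply.
by rewrite /max_deg; apply: (leq_bigmax_seq (F := fst)).
Qed.

Lemma schur_tensorE tau K : (max_deg tau <= K)%N ->
  schur_tensor tau = \prod_(1 <= k < K.+1) schur k (component tau k).
Proof.
move=> tK; rewrite [RHS](big_cat_nat (n := (max_deg tau).+1))//=.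
rewrite [X in _ * X]big_nat_cond [X in _ * X]big1 ?mulr1// => k /andP[/andP[tk _] _].
by rewrite component_default ?schur_nil.
Qed.

(** The Murnaghan-Nakayama rule applied to the factor of degree [k]. *)
Lemma schur_tensor_psum tau k r : is_type tau -> (0 < k)%N -> (0 < r)%N ->
  schur_tensor tau * psum k r =
  \sum_(nu <- ribbons (component tau k) r (size (component tau k) + r))
    ribbon_sgn (dg nu `\` dg (component tau k))%fset *: schur_tensor (set_component tau k nu).
Proof.
move=> htau k0 r0; pose K := maxn k (max_deg tau).
have kI : k \in index_iota 1 K.+1 by rewrite mem_index_iota k0 ltnS leq_maxl.
have pl := component_part k htau.
rewrite (@schur_tensorE tau K) ?leq_maxr// (bigD1_seq k)//= ?iota_uniq//.
rewrite mulrAC murnaghan_nakayama// mulr_suml; apply: eq_big_seq => nu.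
move=> /(mem_ribbons pl r0 (leqnn _))[pnu _].
rewrite (@schur_tensorE _ K) ?max_deg_set ?leq_maxr ?leq_maxl//.
rewrite [in RHS](bigD1_seq k)//= ?iota_uniq// component_set// eqxx scale_mull.
congr (_ *: _); congr (_ * _); apply: eq_bigr => l /negPf lk.
by rewrite component_set// lk.
Qed.

(** The types reached from [sigma] by one step with block [b], as a list without
    repetition: the type reached determines the degree [k], the only one in which
    it differs from [sigma], and then the ribbon. *)
Definition steps (b : block) (sigma : seq block) : seq (seq block) :=
  [seq set_component sigma k nu | k <- divisors b.1,
     nu <- ribbons (component sigma k) (b.1 * b.2 %/ k)
             (size (component sigma k) + b.1 * b.2 %/ k)].

Section Steps.

Variables (b : block) (sigma : seq block).
Hypotheses (hb : is_block b) (hsigma : is_type sigma).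

Let rib k := ribbons (component sigma k) (b.1 * b.2 %/ k)
             (size (component sigma k) + b.1 * b.2 %/ k).

Lemma ribbon_size_gt0 k : k \in divisors b.1 -> (0 < b.1 * b.2 %/ k)%N.
Proof.
case/andP: hb => b10 b20; rewrite -dvdn_divisors// => kb.
have k0 := dvdn_gt0 b10 kb.
by rewrite divn_gt0// (leq_trans (dvdn_leq b10 kb))// leq_pmulr.
Qed.

Lemma divisor_gt0 k : k \in divisors b.1 -> (0 < k)%N.
Proof. by case/andP: hb => b10 _; rewrite -dvdn_divisors//; exact: dvdn_gt0. Qed.

Lemma mem_rib k nu : k \in divisors b.1 ->
  reflect (is_part nu /\ adds_ribbon (b.1 * b.2 %/ k) (component sigma k) nu) (nu \in rib k).
Proof.
by move=> kb; apply: mem_ribbons; [exact: component_part|exact: ribbon_size_gt0|exact: leqnn].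
Qed.

Lemma rib_neq k nu : k \in divisors b.1 -> nu \in rib k -> nu != component sigma k.
Proof.
move=> kb /(mem_rib _ kb)[_ [_ [[|c s] [_ sz R _]]]].
  by have := ribbon_size_gt0 kb; rewrite -sz.
apply/eqP => nuE; move: R; rewrite nuE fsetDv => /fsetP/(_ c).
by rewrite in_fset mem_head.
Qed.

Lemma rib_neq0 k nu : k \in divisors b.1 -> nu \in rib k -> nu != [::].
Proof.
move=> kb /(mem_rib _ kb)[_ [_ [[|c s] [_ sz R _]]]].
  by have := ribbon_size_gt0 kb; rewrite -sz.
apply/eqP => nuE; move: R; rewrite nuE => /fsetP/(_ c).
rewrite in_fsetD !mem_dg nth_nil in_fset mem_head.
by rewrite [X in _ && X](_ : _ = false) ?andbF//; lia.
Qed.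

Lemma step_deg_set k nu : k \in divisors b.1 -> nu \in rib k ->
  step_deg sigma (set_component sigma k nu) = k.
Proof.
move=> kb nur; have k0 := divisor_gt0 kb; have [pnu _] := mem_rib _ kb nur.
rewrite /step_deg; set s := filter _ _.
have ks : k \in s.
  rewrite mem_filter component_set// eqxx (rib_neq kb nur) /=.
  case: nu nur (rib_neq0 kb nur) @s {pnu} => // m nu _ _ s.
  apply/mapP; exists (k, m) => //; rewrite mem_sort mem_cat.
  by apply/orP; right; apply/mapP; exists m => //; rewrite mem_head.
have : {in s, forall l, l = k}.
  by move=> l; rewrite mem_filter component_set//; case: (l =P k) => // _; rewrite eqxx.
by case: s ks => // l s _ H; apply: H; rewrite mem_head.
Qed.

Lemma step_ribbon_set k nu : k \in divisors b.1 -> nu \in rib k ->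
  step_ribbon sigma (set_component sigma k nu) = (dg nu `\` dg (component sigma k))%fset.
Proof.
move=> kb nur; rewrite /step_ribbon step_deg_set//.
by rewrite component_set ?eqxx ?(divisor_gt0 kb)//; have [] := mem_rib _ kb nur.
Qed.

Lemma mem_steps tau :
  reflect (is_type tau /\ trht_step b sigma tau) (tau \in steps b sigma).
Proof.
have [b10 b20] := andP hb.
apply: (iffP allpairsPdep) => [[k [nu [kb nur ->]]]|[htau [k [k0 kb adds eqc]]]].
  have k0 := divisor_gt0 kb; have [pnu adds] := mem_rib _ kb nur.
  split; first exact: set_component_type.
  exists k; split=> //; first by rewrite dvdn_divisors.
    by rewrite component_set// eqxx.
  by move=> l /eqP/negPf lk; rewrite component_set// lk.
have kb' : k \in divisors b.1 by rewrite -dvdn_divisors.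
have ptau := component_part k htau.
exists k, (component tau k); split=> //; first exact/mem_rib.
apply: type_ext => //; first exact: set_component_type.
by move=> l; rewrite component_set//; case: eqP => [->//|/eqc].
Qed.

Lemma steps_uniq : uniq (steps b sigma).
Proof.
apply: allpairs_uniq_dep; first exact: divisors_uniq.
  move=> k kb; apply: ribbons_uniq => //; first exact: component_part.
  exact: ribbon_size_gt0.
move=> _ _ /allpairsPdep[k [nu [kb nur ->]]] /allpairsPdep[k' [nu' [kb' nur' ->]]] /= E.
have kk : k = k' by rewrite -(step_deg_set kb nur) -(step_deg_set kb' nur') E.
case: _ / kk kb' nur' E => kb' nur' /(congr1 (component^~ k)).
have [[pnu _] [pnu' _]] := (mem_rib _ kb nur, mem_rib _ kb nur').
by rewrite !component_set ?(divisor_gt0 kb)// eqxx => ->.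
Qed.

Lemma schur_tensor_P_block :
  schur_tensor sigma * P_block b =
  \sum_(tau <- steps b sigma)
    (ribbon_sgn (step_ribbon sigma tau) * (step_deg sigma tau)%:R) *: schur_tensor tau.
Proof.
have [b10 b20] := andP hb.
rewrite /steps big_allpairs_dep /= [b]surjective_pairing P_blockE//= mulr_sumr.
apply: eq_big_seq => k kb; have k0 := divisor_gt0 kb; have r0 := ribbon_size_gt0 kb.
rewrite mulrnAr schur_tensor_psum// -sumrMnl; apply: eq_big_seq => nu nur.
by rewrite step_deg_set// step_ribbon_set// scalerMnl mulr_natr.
Qed.

End Steps.

Fixpoint trhts (delta : seq block) (sigma : seq block) : seq (seq (seq block)) :=
  if delta is b :: delta' then
    [seq sigma :: T | tau <- steps b sigma, T <- trhts delta' tau]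
  else [:: [:: sigma]].

Lemma mem_trhts delta sigma T : is_type sigma -> all is_block delta ->
  reflect (is_trht (nth [::] T (size delta)) sigma delta T) (T \in trhts delta sigma).
Proof.
move=> hsigma hdelta.
elim: delta sigma T hsigma hdelta => [|b delta IH] sigma T hsigma /=.
  move=> _; rewrite inE; apply: (iffP eqP) => [->|[]].
    by split=> //=; rewrite hsigma.
  by case: T => [//|s [|//]] _ _ /= ->.
move=> /andP[hb hdelta].
apply: (iffP allpairsPdep) => [[tau [T' [taub T'in ->]]]|].
  have [htau step] := mem_steps hb hsigma _ taub.
  have [sz tp T0 _ st] := IH _ _ htau hdelta T'in.
  split=> //=; first by rewrite sz.
    by rewrite hsigma.
  by case=> [|i] /=; [rewrite T0|rewrite ltnS; exact: st].
case: T => [|s [|tau T]] [] // [sz] /and3P[_ htau hT] /= -> _ st.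
exists tau, (tau :: T); split=> //; first by apply/mem_steps => //; split=> //; exact: (st 0%N).
apply/IH => //; split=> //=; first by rewrite sz.
  by rewrite htau.
by move=> i; exact: (st i.+1).
Qed.

Lemma trhts_uniq delta sigma : is_type sigma -> all is_block delta ->
  uniq (trhts delta sigma).
Proof.
elim: delta sigma => //= b delta IH sigma hsigma /andP[hb hdelta].
apply: allpairs_uniq_dep; first exact: steps_uniq.
  by move=> tau /(mem_steps hb hsigma)[htau _]; exact: IH.
move=> _ _ /allpairsPdep[tau [T [taub Tin ->]]] /allpairsPdep[tau' [T' [taub' Tin' ->]]] /= [TT'].
have [htau _] := mem_steps hb hsigma _ taub.
have [htau' _] := mem_steps hb hsigma _ taub'.
have [_ _ T0 _ _] := mem_trhts _ htau hdelta Tin.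
have [_ _ T0' _ _] := mem_trhts _ htau' hdelta Tin'.
by rewrite -TT' T0 in T0'; rewrite TT' T0'.
Qed.

Lemma schur_tensor_P_content delta sigma : is_type sigma -> all is_block delta ->
  schur_tensor sigma * P_content delta =
  \sum_(T <- trhts delta sigma)
    (trht_sgn T * trht_wt T) *: schur_tensor (nth [::] T (size delta)).
Proof.
elim: delta sigma => [|b delta IH] sigma hsigma /=.
  by rewrite big_seq1 /P_content /trht_sgn /trht_wt !big_nil !big_ord0 !mulr1 scale1r.
move=> /andP[hb hdelta]; rewrite /P_content big_cons mulrA -/(P_content delta).
rewrite schur_tensor_P_block// mulr_suml [RHS]big_allpairs_dep /=.
apply: eq_big_seq => tau /(mem_steps hb hsigma)[htau _].
rewrite scale_mull IH// scaler_sumr; apply: eq_big_seq => T Tin.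
have [sz _ T0 _ _] := mem_trhts _ htau hdelta Tin.
rewrite scalerA /trht_sgn /trht_wt /= sz !big_ord_recl /= T0.
by congr (_ *: _); rewrite -!mulrA; congr (_ * _); rewrite mulrCA.
Qed.

(** [schur_tensor_P_content] is a sum over all the tableaux that start at [sigma];
    the statement groups them by their last type. *)
Theorem theorem8 (sigma delta : seq block)
    (hsigma : is_type sigma) (hdelta : all is_block delta) :
  schur_tensor sigma * P_content delta =
  fsum [set tau | is_type tau] (fun tau =>
    (\sum_(T \in [set T | is_trht tau sigma delta T]) trht_sgn T * trht_wt T)
      *: schur_tensor tau).
Proof.
pose L := trhts delta sigma; pose end_type T := nth [::] T (size delta) : seq block.
have memL T := mem_trhts T hsigma hdelta.
have inner tau : \sum_(T \in [set T | is_trht tau sigma delta T]) trht_sgn T * trht_wt T =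
    \sum_(T <- L | end_type T == tau) trht_sgn T * trht_wt T.
  rewrite -[RHS]big_filter; apply: fsbig_list.
  - by rewrite filter_uniq// trhts_uniq.
  - by move=> T; rewrite mem_filter => /andP[/eqP <- /memL].
  move=> T /= Ttau; rewrite mem_filter negb_and.
  have Tend : end_type T = tau by case: Ttau.
  by rewrite Tend eqxx /= => /negP[]; apply/memL; rewrite -/(end_type T) Tend.
rewrite schur_tensor_P_content//; apply/funext => M; rewrite /fsum.
under eq_fsbigr do rewrite inner.
rewrite (@fsbig_list _ _ _ (undup (map end_type L))) ?undup_uniq//; last first.
- move=> tau _; rewrite mem_undup => tauL; rewrite big_seq_cond big1 ?scale0r//.
  by move=> T /andP[TL /eqP Ttau]; case/negP: tauL; rewrite -Ttau map_f.
- move=> tau; rewrite mem_undup => /mapP[T /memL[sz /allP tp _ _ _] ->].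
  by apply: tp; rewrite mem_nth// sz.
rewrite pseries_sum; under [RHS]eq_bigr do rewrite pseries_scale mulr_suml big_mkcond.
rewrite exchange_big /=; apply: eq_big_seq => T TL.
rewrite (bigD1_seq (end_type T)) ?undup_uniq ?mem_undup ?map_f//= eqxx big1 ?addr0//.
by move=> tau; rewrite eq_sym => /negPf ->.
Qed.
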